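(* Let $d=3$. There exists a constant $\kappa_0>1$ such that the following holds for every $1\le\kappa<\kappa_0$. Let $x_1,x_2,x_3>0$ be such that the ratios $x_i/x_j$ are $\kappa$-Diophantine for all $i\neq j$, and let $$g_0=\left(\begin{pmatrix}x_j^{1/2}&0\\0&x_j^{-1/2}\end{pmatrix}\right)_{j=1,2,3}\in\mathrm{SL}(2,\mathbb{R})^3.$$ Then for any $0<\delta<\frac1{\kappa+1}$ and any sufficiently small $\eta>0$ there is $\beta>1$ such that for all $M\ge 1$ and $1\le L\le M^{d-2}$, $$\frac1L\int_{M^{-1-\eta}<|\xi|\le L}\alpha_3\big(g_0n(\xi)a(\log M)\big)^\beta\,d\xi=O_{\beta,\kappa}\Big(1+\frac1LM^{d-2-\delta}\Big).$$
   Context: Let $G=\mathrm{SL}(2,\mathbb{R})$, $\Gamma=\mathrm{SL}(2,\mathbb{Z})$, and $n(\xi)=\begin{pmatrix}1&\xi\\0&1\end{pmatrix}$, $a(t)=\begin{pmatrix}e^{-t}&0\\0&e^t\end{pmatrix}$; elements of $G$ are identified with their diagonal embeddings in $G^3$. For $g=\left(\begin{pmatrix}a_j&b_j\\c_j&d_j\end{pmatrix}\right)_{j=1,2,3}\in G^3$ put $\rho_3(g)=\prod_{j=1}^3|(c_j,d_j)|$ (Euclidean norms of the bottom rows) and $\alpha_3(g)=\max_{\gamma\in\Gamma^3}\rho_3(\gamma g)^{-1}$. For $\kappa\ge1$, a real number $x$ is $\kappa$-Diophantine if there is $C>0$ such that $|x-\frac rq|\ge C|q|^{-\kappa-1}$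 for all $r\in\mathbb{Z}$, $q\in\mathbb{Z}\setminus\{0\}$. The implied constant may also depend on the fixed data $x_1,x_2,x_3,\delta,\eta$, but not on $L,M$. *)

(* Defs.v *)
From HB Require Import structures.
From mathcomp Require Import all_boot all_order all_algebra.
From mathcomp Require Import all_classical all_reals all_analysis.
From mathcomp Require Import ring lra.
Import Order.TTheory GRing.Theory Num.Theory.
Import numFieldNormedType.Exports.

Set Implicit Arguments.
Unset Strict Implicit.
Unset Printing Implicit Defensive.

Local Open Scope classical_set_scope.
Local Open Scope ring_scope.

Definition mx2 (R : realType) (a b c d : R) : 'M[R]_2 :=
  \matrix_(i < 2, j < 2) nth 0 (nth [::] [:: [:: a; b]; [:: c; d]] i) j.

Definition nmx (R : realType) (xi : R) : 'M[R]_2 := mx2 1 xi 0 1.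

Definition amx (R : realType) (t : R) : 'M[R]_2 := mx2 (expR (- t)) 0 0 (expR t).

(* For matrices, `|_| is the max norm, hence the explicit Euclidean norm. *)
Definition rho (R : realType) (n : nat) (g : 'I_n -> 'M[R]_2) : R :=
  \prod_(j < n) Num.sqrt (g j ord_max ord0 ^+ 2 + g j ord_max ord_max ^+ 2).

Definition SL2Z (n : nat) : set ('I_n -> 'M[int]_2) :=
  [set gamma | forall j, \det (gamma j) = 1].
Arguments SL2Z n : clear implicits.

Definition lmulZ (R : realType) (n : nat) (gamma : 'I_n -> 'M[int]_2)
    (g : 'I_n -> 'M[R]_2) : 'I_n -> 'M[R]_2 :=
  fun j => map_mx intr (gamma j) *m g j.

(* On SL(2,R)^n the supremum is finite by [alpha_has_sup] below (and, the
   orbits of SL(2,Z) being discrete, it is a maximum). *)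
Definition alpha (R : realType) (n : nat) (g : 'I_n -> 'M[R]_2) : R :=
  sup [set (rho (lmulZ gamma g))^-1 | gamma in SL2Z n].

Definition diophantine (R : realType) (kappa x : R) : Prop :=
  exists2 C : R, 0 < C & forall r q : int, q != 0 ->
    C * `|q%:~R| `^ (- kappa - 1) <= `|x - r%:~R / q%:~R|.

Definition g0 (R : realType) (n : nat) (x : 'I_n -> R) : 'I_n -> 'M[R]_2 :=
  fun j => mx2 (x j `^ (2^-1)) 0 0 (x j `^ (- 2^-1)).

Lemma det_mx2 (R : comPzRingType) (A : 'M[R]_2) :
  \det A = A ord0 ord0 * A ord_max ord_max - A ord0 ord_max * A ord_max ord0.
Proof.
have E : lift ord0 (ord0 : 'I_1) = ord_max :> 'I_2 by apply/val_inj.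
have E' : lift ord_max (ord0 : 'I_1) = ord0 :> 'I_2 by apply/val_inj.
rewrite (expand_det_row _ ord0) !big_ord_recl big_ord0 /cofactor !det_mx11 !mxE.
rewrite (_ : 0 = ord0 :> 'I_1) ?E ?E' /=; last exact/val_inj.
by rewrite addr0 expr0 expr1 mul1r mulN1r mulrN.
Qed.

Lemma alpha_has_sup (R : realType) (n : nat) (g : 'I_n -> 'M[R]_2) :
  (forall j, \det (g j) = 1) ->
  has_sup [set (rho (lmulZ gamma g))^-1 | gamma in SL2Z n].
Proof.
move=> dg; split.
  by exists (rho (lmulZ (fun=> 1%:M) g))^-1, (fun=> 1%:M) => // j; rewrite det1.
pose F j := g j ord0 ord0 ^+ 2 + g j ord0 ord_max ^+ 2 +
            (g j ord_max ord0 ^+ 2 + g j ord_max ord_max ^+ 2).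
exists (\prod_(j < n) Num.sqrt (F j)) => _ [gamma Ggamma <-].
rewrite /rho -prodfV; apply: ler_prod => j _.
rewrite invr_ge0 sqrtr_ge0 /= /lmulZ.
have := dg j; have := Ggamma j; rewrite !det_mx2 !mxE !big_ord_recl !big_ord0 !mxE.
have -> : lift ord0 (ord0 : 'I_1) = ord_max :> 'I_2 by apply/val_inj.
rewrite /F !addr0.
move: (gamma j ord_max ord0) (gamma j ord_max ord_max) => p q.
move: (gamma j ord0 ord0) (gamma j ord0 ord_max) => r s drs.
move: (g j ord0 ord0) (g j ord0 ord_max) (g j ord_max ord0) (g j ord_max ord_max).
move=> a b c d dabcd.
have pq1 : 1 <= (p%:~R : R) ^+ 2 + q%:~R ^+ 2.
  rewrite -!rmorphXn -rmorphD /= (ler_int R 1) -gtz0_ge1 lt_neqAle.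
  rewrite addr_ge0 ?sqr_ge0 // andbT eq_sym paddr_eq0 ?sqr_ge0 // !sqrf_eq0.
  by apply/negP => /andP[/eqP p0 /eqP q0]; move: drs; rewrite p0 q0 !mulr0 subr0.
set P : R := p%:~R in pq1 *; set Q : R := q%:~R in pq1 *.
set u := P * a + Q * c; set v := P * b + Q * d.
have eP : P = u * d - v * c.
  by rewrite -[LHS]mulr1 -dabcd /u /v; ring.
have eQ : Q = v * a - u * b.
  by rewrite -[LHS]mulr1 -dabcd /u /v; ring.
set N := u ^+ 2 + v ^+ 2; set f := _ ^+ 2 + _ ^+ 2 + _.
have NF : 1 <= N * f.
  apply: (le_trans pq1); rewrite eP eQ -subr_ge0.
  rewrite (_ : _ - _ = (u * c + v * d) ^+ 2 + (u * a + v * b) ^+ 2).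
    by rewrite addr_ge0 ?sqr_ge0.
  by rewrite /N /f; ring.
have N0 : 0 <= N by rewrite addr_ge0 ?sqr_ge0.
have Np : 0 < N by rewrite lt_neqAle N0 andbT; apply: contraTneq NF => <-; rewrite mul0r ler10.
by rewrite -sqrtrV // ler_wsqrtr // -[N^-1]mulr1 ler_pdivrMl.
Qed.

(* Main.v *)
Require Import Defs.
From mathcomp Require Import all_boot all_order all_algebra.
From mathcomp Require Import all_classical all_reals all_analysis.
From mathcomp Require Import ring lra zify.
Import Order.TTheory GRing.Theory Num.Theory.
Import numFieldNormedType.Exports.

(* [alpha_3] of g_0 n(xi) a(log M) is the product over j of the maximum, over primitive
   integer rows (p, q), of the inverse norm of
   (p x_j^(1/2) / M, M (p x_j^(1/2) xi + q x_j^(-1/2))).  The j-th factor is of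
   size u (up to constants) only if |p x_j |xi| - q| <= 1/(M u) for some p <= M/u.
   If u >= v are the two largest factors, for indices i <> j, the product is at most
   u v^2, so it suffices to bound the measure of the xi lying in both bands.  This forces
   |q1 p2 x_j - q2 p1 x_i| << 1/(uv), a relation n x_j - m x_i ~ 0 with n = p2 q1 and
   m = p1 q2.  By the Diophantine condition the admissible n are separated by
   (uv)^(1/kappa), and each comes from O(n^eps) factorizations: the measure is
   << L M^eps (uv)^(-1-1/kappa), which is enough unless u is at most a small power of M.
   For such small u one removes the M^eps: for fixed p1, p2 Dirichlet's theorem gives b
   with b p2 x_j / (p1 x_i) close to an integer, and there are
   O(1 + L/(uv) + L p1/b) pairs (q1, q2); the sum of the terms L p1/b is again a sum over
   near-solutions n x_j ~ m x_i, now with n = b p2 and error 1/L, which saves a power of L.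
   When L too is a small power of M, the lossy bound is absorbed by M^(1-delta). *)

Local Open Scope classical_set_scope.
Local Open Scope ring_scope.

(** * Divisors and harmonic sums *)

(** A divisor is determined by its p-adic valuation, at most e, and by its part prime to p, which
    divides m. *)
Lemma size_divisors_primeM (p e m : nat) :
  prime p -> (0 < m)%N -> ~~ (p %| m)%N ->
  (size (divisors (p ^ e * m)) <= e.+1 * size (divisors m))%N.
Proof.
move=> pp m0 pm.
have n0 : (0 < p ^ e * m)%N by rewrite muln_gt0 expn_gt0 (prime_gt0 pp).
have lpm : logn p m = 0%N by apply/eqP; rewrite lognE pp m0 (negbTE pm).
have -> : (e.+1 * size (divisors m))%N =
   size [seq (p ^ i * d)%N | i <- iota 0 e.+1, d <- divisors m].
  by rewrite size_allpairs size_iota.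
apply: uniq_leq_size; first exact: divisors_uniq.
move=> d; rewrite -dvdn_divisors // => dn.
have d0 : (0 < d)%N := dvdn_gt0 n0 dn.
apply/allpairsP; exists (logn p d, partn d (negn p))%N; split; rewrite /fst /snd.
- rewrite mem_iota add0n ltnS leq0n /=.
  have := dvdn_leq_log p n0 dn.
  by rewrite lognM ?expn_gt0 ?(prime_gt0 pp)// pfactorK// lpm addn0.
- rewrite -dvdn_divisors//.
  have := partn_dvd (negn p) n0 dn.
  rewrite partnM ?expn_gt0 ?(prime_gt0 pp)//.
  rewrite (_ : partn (p ^ e) (negn p) = 1)%N ?mul1n; last first.
    by apply: part_p'nat; rewrite pnatNK pnatX pnat_id.
  move=> /dvdn_trans; apply; exact: dvdn_part.
- by rewrite -p_part partnC.
Qed.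

(** Strong induction on N. When [P N] holds, the other elements are at most N - s, and s^-1 ln(N/s)
    decreases by at least 1/N from N to N - s, which pays for the new term. *)
Lemma sep_harmonic (R : realType) (P : pred nat) (s : R) (N : nat) :
  0 < s -> (forall n, P n -> s <= n%:R) ->
  (forall m n, P m -> P n -> (m < n)%N -> s <= n%:R - m%:R) ->
  s <= N%:R ->
  \sum_(0 <= n < N.+1 | P n) (n%:R : R)^-1 <= s^-1 * (1 + ln (N%:R / s)).
Proof.
move=> s0 Ps Psep.
have base (m : nat) : (m%:R < s) -> \sum_(0 <= n < m.+1 | P n) (n%:R : R)^-1 = 0.
  move=> ms; rewrite big_nat_cond big1// => n /andP[/andP[_ nm]] /Ps sn.
  by move: (lt_le_trans ms sn); rewrite ltr_nat ltnNge -ltnS nm.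
elim/ltn_ind: N => N IH sN.
have N0 : (0 : R) < N%:R := lt_le_trans s0 sN.
have lnN : 0 <= ln (N%:R / s) by rewrite ln_ge0// ler_pdivlMr// mul1r.
rewrite big_mkcond big_nat_recr//= -big_mkcond /=.
case: ifPn => PN; last first.
  rewrite addr0; case: N IH sN N0 lnN PN => [|N] IH sN N0 lnN PN; first by rewrite ltxx in N0.
  have [Ns|Ns] := leP s N%:R; last first.
    by rewrite base// mulr_ge0// ?invr_ge0 ?(ltW s0)// addr_ge0.
  apply: (le_trans (IH _ _ Ns)); first by [].
  rewrite ler_pM2l ?invr_gt0// lerD2l ler_ln ?posrE ?divr_gt0//; last exact: lt_le_trans Ns.
  by rewrite ler_pM2r ?invr_gt0// ler_nat.
pose N' := Num.truncn (N%:R - s).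
have Ns0 : 0 <= N%:R - s by rewrite subr_ge0.
have /andP[N'1 N'2] := truncn_itv Ns0.
have N'N : (N' < N)%N by rewrite -(ltr_nat R); apply: le_lt_trans N'1 _; lra.
have -> : \sum_(0 <= i < N | P i) (i%:R : R)^-1 = \sum_(0 <= i < N'.+1 | P i) (i%:R : R)^-1.
  rewrite (big_cat_nat _ (n := N'.+1))//= [X in _ + X]big_nat_cond.
  rewrite [X in _ + X]big1 ?addr0// => i /andP[/andP[N'i iN] Pi].
  have := Psep _ _ Pi PN iN; move: N'2; rewrite -/N'.
  have : (N'.+1%:R : R) <= i%:R by rewrite ler_nat.
  lra.
(* If N' < s the earlier sum is empty, and 1/N <= 1/s suffices. *)
have [sN'|N's] := leP s N'%:R; last first.
  rewrite base// add0r (@le_trans _ _ s^-1)//; first by rewrite lef_pV2.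
  by rewrite ler_peMr ?invr_ge0 ?(ltW s0)// lerDl.
have key : ln ((N%:R - s) / s) <= ln (N%:R / s) - s / N%:R.
  have -> : (N%:R - s) / s = (N%:R / s) * (1 + - (s / N%:R)).
    by field; rewrite ?gt_eqF.
  have sNs : s < N%:R.
    by apply: le_lt_trans sN' _; rewrite ltr_nat.
  have sNs' : s / N%:R < 1 by rewrite ltr_pdivrMr// mul1r.
  rewrite lnM ?posrE ?divr_gt0//; last by lra.
  by rewrite lerD2l le_ln1Dx// ltrN2.
apply: (@le_trans _ _ (s^-1 * (1 + ln ((N%:R - s) / s)) + N%:R^-1)).
  rewrite lerD2r; apply: (le_trans (IH _ N'N sN')).
  rewrite ler_pM2l ?invr_gt0// lerD2l ler_ln ?posrE ?divr_gt0//.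
  - by rewrite ler_pM2r ?invr_gt0.
  - exact: lt_le_trans sN'.
  - by apply: lt_le_trans N'1; exact: lt_le_trans sN'.
apply: (@le_trans _ _ (s^-1 * (1 + (ln (N%:R / s) - s / N%:R)) + N%:R^-1)).
  by rewrite lerD2r ler_pM2l ?invr_gt0// lerD2l.
rewrite le_eqVlt; apply/orP; left; apply/eqP; field; rewrite ?gt_eqF//.
Qed.

Lemma ln_le_powR (R : realType) (s y : R) : 0 < s -> 1 <= y -> 1 + ln y <= (1 + s^-1) * y `^ s.
Proof.
move=> s0 y1; have y0 : 0 < y by lra.
have h1 : 1 <= y `^ s by rewrite -(powRr0 y); apply: ler_powR => //; exact: ltW.
have h2 : s * ln y <= y `^ s.
  rewrite -ln_powR; have h := @ln_sublinear R (y `^ s) (powR_gt0 _ y0); exact: ltW.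
have h3 : ln y <= s^-1 * y `^ s by rewrite ler_pdivlMl.
rewrite mulrDl mul1r; exact: lerD.
Qed.

(** With f the quotient of e by k, e + 1 <= k (f + 1) <= k 2^f <= k y^(k f) <= k y^e. It is applied
    to the k-th root y of a prime: with k itself for small primes, and with 1 in place of k once y
    >= 2. *)
Lemma leq_S_root_pow (R : realDomainType) (k e : nat) (y : R) :
  (0 < k)%N -> 0 <= y -> 2 <= y ^+ k -> e.+1%:R <= k%:R * y ^+ e.
Proof.
move=> k0 y0 yk.
have y1 : 1 <= y by rewrite -(@expr_ge1 _ k)//; lra.
have h2f (f : nat) : (f.+1%:R : R) <= 2 ^+ f.
  elim: f => [|f IH]; first by rewrite expr0.
  rewrite exprS -[f.+2]addn1 natrD.
  have : (1 : R) <= f.+1%:R by rewrite ler1n.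
  lra.
have h1 : e.+1%:R <= k%:R * (e %/ k).+1%:R :> R.
  by rewrite -natrM ler_nat mulnC ltn_ceil.
apply: (le_trans h1); rewrite ler_pM2l ?ltr0n//.
apply: (le_trans (h2f _)).
apply: (@le_trans _ _ ((y ^+ k) ^+ (e %/ k))).
  by rewrite lerXn2r ?nnegrE ?exprn_ge0.
by rewrite -exprM ler_weXn2l// mulnC leq_trunc_div.
Qed.

Lemma primes_pfactorM (p e m : nat) : prime p -> (0 < e)%N -> (0 < m)%N ->
  ~~ (p %| m)%N -> perm_eq (primes (p ^ e * m)) (p :: primes m).
Proof.
move=> pp e0 m0 pm; apply: uniq_perm; rewrite ?primes_uniq//=.
  by rewrite primes_uniq andbT mem_primes pp m0 (negbTE pm).
move=> q; rewrite primesM ?expn_gt0 ?(prime_gt0 pp)// primesX// primes_prime//.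
by rewrite inE in_cons.
Qed.

(** Peel off the least prime factor p, of exponent e. If p >= 2^k then p^(1/k) >= 2 and e + 1 <=
    p^(e/k); a smaller prime loses at most a factor k. *)
Lemma size_divisors_le_prod (R : realType) (k n : nat) : (0 < k)%N -> (0 < n)%N ->
  (size (divisors n))%:R <=
    n%:R `^ (k%:R^-1) * \prod_(p <- primes n | (p < 2 ^ k)%N) k%:R :> R.
Proof.
move=> k0; elim/ltn_ind: n => n IH n0.
have [n1|n1] := leqP n 1.
  have -> : n = 1%N by apply/eqP; rewrite eqn_leq n1 n0.
  by rewrite big_nil mulr1 powR1.
set p := pdiv n; have pp : prime p := pdiv_prime n1.
have [m pm nE] := pfactor_coprime pp n0.
set e := logn p n in nE.
have pm' : ~~ (p %| m)%N by rewrite -prime_coprime.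
have e0 : (0 < e)%N by rewrite logn_gt0 mem_primes pp n0 pdiv_dvd.
have m0 : (0 < m)%N by move: n0; rewrite nE muln_gt0 => /andP[].
have mn : (m < n)%N.
  by rewrite nE -{1}(muln1 m) ltn_pmul2l// -(expn0 p) ltn_exp2l// prime_gt1.
have nE' : n = (p ^ e * m)%N by rewrite mulnC.
have key : e.+1%:R <= (p ^ e)%:R `^ (k%:R^-1) * (if (p < 2 ^ k)%N then k%:R else 1) :> R.
  have -> : ((p ^ e)%:R : R) `^ (k%:R^-1) = (p%:R `^ (k%:R^-1)) ^+ e.
    by rewrite natrX -powR_mulrn// -powRrM mulrC powRrM powR_mulrn// powR_ge0.
  set y := p%:R `^ _.
  have y0 : 0 <= y by apply: powR_ge0.
  have yk : y ^+ k = p%:R.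
    by rewrite -powR_mulrn// -powRrM mulVf ?powRr1// pnatr_eq0 -lt0n.
  have [pk|pk] := ltnP.
    by rewrite mulrC; apply: leq_S_root_pow => //; rewrite yk ler_nat prime_gt1.
  have y2 : 2 <= y.
    rewrite -(@ler_pXn2r _ k)// ?nnegrE//.
    by rewrite yk -natrX ler_nat.
  by rewrite mulr1; have := @leq_S_root_pow R 1 e y isT y0 y2; rewrite mul1r.
have -> : \prod_(q <- primes n | (q < 2 ^ k)%N) k%:R =
    (if (p < 2 ^ k)%N then k%:R else 1) * \prod_(q <- primes m | (q < 2 ^ k)%N) k%:R :> R.
  rewrite {1}nE' (perm_big _ (primes_pfactorM _ _ _ pp e0 m0 pm'))/= big_cons.
  by case: ifP; rewrite ?mul1r.
rewrite {2}nE' natrM powRM//.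
apply: (@le_trans _ _ (e.+1%:R * (size (divisors m))%:R)).
  by rewrite -natrM ler_nat nE'; apply: size_divisors_primeM.
by rewrite mulrACA; apply: ler_pM => //; exact: IH.
Qed.

(** The divisor bound O(n^epsilon): at most 2^k primes lie below 2^k, so the losses multiply to at
    most k^(2^k). *)
Lemma size_divisors_le (R : realType) (k : nat) : (0 < k)%N ->
  exists2 C : R, 0 < C & forall n, (0 < n)%N ->
    (size (divisors n))%:R <= C * n%:R `^ (k%:R^-1).
Proof.
move=> k0; exists (k%:R ^+ (2 ^ k)); first by rewrite exprn_gt0// ltr0n.
move=> n n0; apply: (le_trans (size_divisors_le_prod _ _ _ k0 n0)).
rewrite mulrC ler_wpM2r ?powR_ge0//.
rewrite big_const_seq iter_mulr_1 ler_weXn2l ?ler1n//.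
rewrite -size_filter.
apply: (@leq_trans (size (iota 0 (2 ^ k)))); last by rewrite size_iota.
apply: uniq_leq_size; first by rewrite filter_uniq// primes_uniq.
by move=> q; rewrite mem_filter mem_iota => /andP[].
Qed.

(* Pigeonhole on the fractional parts of [i theta], [i <= N]. *)
Lemma dirichlet_approx (R : realType) (theta : R) (N : nat) : (0 < N)%N -> 0 < theta ->
  exists a b : nat, [/\ (0 < b <= N)%N & `|b%:R * theta - a%:R| <= N%:R^-1].
Proof.
move=> N0 th0.
have NR0 : (0 : R) < N%:R by rewrite ltr0n.
pose fr (i : nat) : R := i%:R * theta - (Num.truncn (i%:R * theta))%:R.
have frP i : 0 <= fr i < 1.
  have /andP[h1 h2] := @truncn_itv R (i%:R * theta) (mulr_ge0 (ler0n _ _) (ltW th0)).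
  rewrite /fr subr_ge0 h1 /= ltrBlDr addrC; apply: lt_le_trans h2 _.
  by rewrite -addn1 natrD.
have box i : (Num.truncn (fr i * N%:R) < N)%N.
  have /andP[f0 f1] := frP i.
  rewrite -(ltr_nat R); apply: le_lt_trans (_ : fr i * N%:R < N%:R).
    by rewrite truncn_le mulr_ge0// ltW.
  by rewrite -[ltRHS]mul1r ltr_pM2r.
pose g (i : 'I_N.+1) : 'I_N := Ordinal (box i).
have /injectivePn [i [j ij gij]] : ~~ injectiveb g.
  apply/injectiveP => ginj; have := leq_card _ ginj.
  by rewrite !card_ord ltnn.
wlog lt_ij : i j ij gij / (i < j)%N.
  move=> H; have [lij|lji|/ord_inj eij] := ltngtP i j.
  - exact: (H i j).
  - by apply: (H j i) => //; rewrite eq_sym.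
  - by rewrite eij eqxx in ij.
have close : `|fr j - fr i| <= N%:R^-1.
  have := congr1 val gij; rewrite /= => gE.
  have /andP[a1 a2] := @truncn_itv R (fr i * N%:R) (mulr_ge0 (andP (frP i)).1 (ltW NR0)).
  have /andP[b1 b2] := @truncn_itv R (fr j * N%:R) (mulr_ge0 (andP (frP j)).1 (ltW NR0)).
  rewrite gE in a1 a2.
  rewrite -[leRHS]mul1r ler_pdivlMr// -(ger0_norm (ltW NR0)) -normrM mulrBl ler_norml.
  rewrite -natr1 in a2; rewrite -natr1 in b2; apply/andP; split; lra.
have trm : (Num.truncn (i%:R * theta) <= Num.truncn (j%:R * theta))%N.
  by apply: le_truncn; rewrite ler_pM2r// ler_nat ltnW.
exists (Num.truncn (j%:R * theta) - Num.truncn (i%:R * theta))%N, (j - i)%N; split.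
  by rewrite subn_gt0 lt_ij /= (leq_trans (leq_subr _ _))// -ltnS.
rewrite (natrB _ (ltnW lt_ij)) (natrB _ trm); move: close; rewrite /fr.
by rewrite (_ : _ - _ - (_ - _) = (j%:R - i%:R) * theta -
  ((Num.truncn (j%:R * theta))%:R - (Num.truncn (i%:R * theta))%:R)); last by ring.
Qed.

(** * Diophantine approximation *)

(** Dividing by the gcd keeps b <= N and does not increase the error. Coprimality is what
    [card_approx] asks for. *)
Lemma dirichlet_coprime (R : realType) (theta : R) (N : nat) : (0 < N)%N -> 0 < theta ->
  exists a b : nat,
    [/\ coprime a b, (0 < b <= N)%N & `|b%:R * theta - a%:R| <= N%:R^-1].
Proof.
move=> N0 th0; have [a [b [/andP[b0 bN] ab]]] := dirichlet_approx _ _ _ N0 th0.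
set g := gcdn a b; have g0 : (0 < g)%N by rewrite gcdn_gt0 b0 orbT.
have aE : a = (a %/ g * g)%N by rewrite divnK ?dvdn_gcdl.
have bE : b = (b %/ g * g)%N by rewrite divnK ?dvdn_gcdr.
have b'0 : (0 < b %/ g)%N by rewrite divn_gt0// dvdn_leq// dvdn_gcdr.
exists (a %/ g)%N, (b %/ g)%N; split.
- by rewrite /coprime -(eqn_pmul2r g0) muln_gcdl -aE -bE mul1n.
- by rewrite b'0 (leq_trans (leq_div _ _)).
- apply: le_trans ab; rewrite {2}aE {2}bE !natrM.
  rewrite [X in _ <= `|X|](_ : _ = g%:R * ((b %/ g)%:R * theta - (a %/ g)%:R)); last by ring.
  by rewrite normrM normr_nat ler_peMl// ler1n.
Qed.

Lemma natr_dist_lt1 (R : numDomainType) (m n : nat) :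
  `|m%:R - n%:R : R| < 1 -> m = n.
Proof.
wlog mn : m n / (m <= n)%N.
  by move=> H; case/orP: (leq_total m n) => mn h; [|symmetry]; apply: H; rewrite // distrC.
rewrite distrC -natrB// normr_nat (_ : 1 = 1%:R)// ltr_nat ltnS leqn0 subn_eq0 => nm.
by apply/eqP; rewrite eqn_leq mn.
Qed.

(* Inside a window of b/2 consecutive values of q the fractional parts of [q theta]
   are 1/(2b)-separated. *)
Lemma card_approx (R : realType) (theta rho : R) (a b N : nat) (I : finType)
    (P : pred I) (q m : I -> nat) :
  coprime a b -> (0 < b)%N -> `|b%:R * theta - a%:R| <= b%:R^-1 -> 0 <= rho ->
  {in P &, forall i j, q i = q j -> m i = m j -> i = j} ->
  (forall i, P i -> (q i < N)%N /\ `|(q i)%:R * theta - (m i)%:R| <= rho) ->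
  #|P|%:R <= (2 * N%:R / b%:R + 1) * (4 * rho * b%:R + 1).
Proof.
move=> cab b0 bth rho0 inj HP.
have bR : (0 : R) < b%:R by rewrite ltr0n.
(* Rounding b/2 up serves both ends: u < w implies 2u < b, while b <= 2w bounds the number of
   windows by 2N/b + 1. *)
pose w := uphalf b.
have w0 : (0 < w)%N by rewrite uphalf_gt0.
have wR : (0 : R) < w%:R by rewrite ltr0n.
have b2w : (b <= 2 * w)%N.
  by rewrite /w uphalf_half; have := odd_double_half b; lia.
(* The error, shifted to be nonnegative and rescaled so that boxes of width 1/(2b) become unit
   intervals. *)
pose y i := ((q i)%:R * theta - (m i)%:R + rho) * (2 * b%:R).
have y0 i : P i -> 0 <= y i.
  move=> /HP[_]; rewrite ler_norml => /andP[h _].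
  by apply: mulr_ge0; [lra|rewrite mulr_ge0// ltW].
have y4 i : P i -> y i <= 4 * rho * b%:R.
  move=> /HP[_]; rewrite ler_norml => /andP[_ h].
  apply: (@le_trans _ _ ((rho + rho) * (2 * b%:R))); last by lra.
  by rewrite ler_pM2r ?mulr_gt0// lerD2r.
pose K := Num.truncn (4 * rho * b%:R).
pose f i : 'I_(N %/ w).+1 * 'I_K.+1 := (inord (q i %/ w), inord (Num.truncn (y i))).
have bnd1 i : P i -> (q i %/ w < (N %/ w).+1)%N.
  by move=> /HP[h _]; rewrite ltnS leq_div2r// ltnW.
have bnd2 i : P i -> (Num.truncn (y i) < K.+1)%N.
  by move=> Pi; rewrite ltnS le_truncn// y4.
have finj : {in P &, injective f}.
  move=> i j; wlog qij : i j / (q i <= q j)%N.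
    move=> H Pi Pj fE; case/orP: (leq_total (q i) (q j)) => h; first exact: H.
    by symmetry; apply: H.
  move=> Pi Pj [] /(congr1 val) /=; rewrite !inordK ?bnd1// => qE.
  move=> /(congr1 val) /=; rewrite !inordK ?bnd2// => yE.
  have uw : (q j - q i < w)%N.
    rewrite (divn_eq (q j) w) (divn_eq (q i) w) qE subnDl.
    by apply: leq_ltn_trans (leq_subr _ _) _; rewrite ltn_mod.
  set u := (q j - q i)%N in uw.
  have u2b : (2 * u < b)%N by move: uw; rewrite /w uphalf_half; have := odd_double_half b; lia.
  have qjE : q j = (q i + u)%N by rewrite subnKC.
  have /andP[i1 i2] := truncn_itv (y0 _ Pi).
  have /andP[j1 j2] := truncn_itv (y0 _ Pj).
  rewrite -natr1 in i2; rewrite -natr1 in j2; rewrite yE in i1 i2.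
  have d1 : `|y j - y i| < 1 by rewrite ltr_norml; apply/andP; split; lra.
  have d2 : `|u%:R * (b%:R * theta - a%:R)| < 2^-1.
    rewrite normrM normr_nat; apply: (@le_lt_trans _ _ (u%:R * b%:R^-1)).
      by rewrite ler_wpM2l.
    rewrite ltr_pdivrMr// ltr_pdivlMl//.
    by rewrite -natrM ltr_nat.
  (* Replacing b theta by a costs less than 1/2, and so does sharing a box. The integers therefore
     agree, b divides u a, and u < b forces u = 0. *)
  have /natr_dist_lt1 e : `|(u * a + b * m i)%:R - (b * m j)%:R : R| < 1.
    rewrite (_ : _ - _ = (y j - y i) / 2 - u%:R * (b%:R * theta - a%:R)); last first.
      by rewrite /y qjE !natrD !natrM; field.
    apply: le_lt_trans (ler_normB _ _) _.
    rewrite normrM (ger0_norm (_ : 0 <= 2^-1))//.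
    by move: d1 d2; set z1 := `|_|; set z2 := `|_|; lra.
  have bu : (b %| u)%N.
    rewrite -(@Gauss_dvdl b u a) 1?coprime_sym//.
    by rewrite -(dvdn_addl (n := b * m i)) ?dvdn_mulr// e dvdn_mulr.
  have u0 : u = 0%N.
    case: (posnP u) => // u_gt0; have := leq_trans (dvdn_leq u_gt0 bu) (leq_pmull u (ltn0Sn 1)).
    by rewrite leqNgt u2b.
  apply: inj => //; first by rewrite qjE u0 addn0.
  by move/eqP: e; rewrite u0 mul0n add0n eqn_pmul2l// => /eqP.
have cardle : (#|P| <= (N %/ w).+1 * K.+1)%N.
  rewrite -(card_in_imset finj) -[X in (_ <= X * _)%N]card_ord.
  by rewrite -[X in (_ <= _ * X)%N]card_ord -card_prod max_card.
apply: (@le_trans _ _ ((N %/ w).+1 * K.+1)%:R).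
  by rewrite -(ler_nat R) in cardle.
rewrite natrM -[X in X * _]natr1 -[X in _ * X <= _]natr1 ler_pM//.
- rewrite lerD2r ler_pdivlMr//.
  apply: (@le_trans _ _ ((N %/ w)%:R * (2 * w)%:R)).
    by rewrite ler_wpM2l// ler_nat.
  rewrite -[leLHS]natrM -[leRHS](natrM _ 2) ler_nat mulnCA leq_mul2l.
  by rewrite leq_trunc_div orbT.
- by rewrite lerD2r truncn_le// mulr_ge0 ?mulr_ge0// ltW.
Qed.

(** Telescoping of 1/sqrt(n + 1) <= 2 (sqrt(n + 1) - sqrt n). *)
Lemma sum_inv_sqrt_le (R : realType) (N : nat) (Y : R) : 0 <= Y ->
  \sum_(p < N | (0 < p)%N && (p%:R <= Y)) (Num.sqrt p%:R)^-1 <= 2 * Num.sqrt Y.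
Proof.
move=> Y0.
have step (n : nat) : \sum_(0 <= p < n.+1 | (0 < p)%N) (Num.sqrt (p%:R : R))^-1
    <= 2 * Num.sqrt n%:R.
  elim: n => [|n IH].
    by rewrite big_mkcond big_nat1 /= sqrtr0 mulr0.
  rewrite big_mkcond big_nat_recr//= -big_mkcond /=.
  apply: (le_trans (lerD IH (lexx _))).
  set s := Num.sqrt n%:R; set t := Num.sqrt n.+1%:R.
  have t0 : 0 < t by rewrite sqrtr_gt0.
  have s0 : 0 <= s by rewrite sqrtr_ge0.
  have sE : s ^+ 2 = n%:R by rewrite sqr_sqrtr.
  have tE : t ^+ 2 = n%:R + 1 by rewrite sqr_sqrtr// natr1.
  rewrite -(@ler_pM2r _ t)// mulrDl mulVf ?gt_eqF//.
  nra.
have tN : (Num.truncn Y)%:R <= Y by rewrite truncn_le.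
apply: (@le_trans _ _ (\sum_(0 <= p < (Num.truncn Y).+1 | (0 < p)%N) (Num.sqrt (p%:R : R))^-1)).
  rewrite -(big_mkord (fun p => (0 < p)%N && (p%:R <= Y)) (fun p => (Num.sqrt (p%:R : R))^-1)).
  set T := (Num.truncn Y).+1.
  have nn p : 0 <= (Num.sqrt (p%:R : R))^-1 by rewrite invr_ge0 sqrtr_ge0.
  have lt p : p%:R <= Y -> (p < T)%N by move=> h; rewrite ltnS truncn_ge_nat.
  have [NT|/ltnW TN] := leqP N T.
    rewrite [leRHS](big_cat_nat _ (n := N))//=.
    apply: ler_wpDr; first by apply: sumr_ge0.
    rewrite big_mkcondr; apply: ler_sum => p _; by case: ifP.
  rewrite (big_cat_nat _ (n := T))//= [X in _ + X]big_nat_cond [X in _ + X]big1 ?addr0.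
    rewrite big_mkcondr; apply: ler_sum => p _; by case: ifP.
  by move=> p /and3P[/andP[Tp _] _ /lt]; rewrite ltnNge Tp.
apply: (le_trans (step _)); rewrite ler_pM2l//.
exact: ler_wsqrtr.
Qed.

Lemma sum_geometric_le (R : realFieldType) (r : R) (N : nat) : 0 <= r < 1 ->
  \sum_(i < N) r ^+ i <= (1 - r)^-1.
Proof.
move=> /andP[r0 r1]; have r1' : 0 < 1 - r by lra.
rewrite -(@ler_pM2l _ (1 - r))// mulfV ?gt_eqF//.
rewrite (_ : (1 - r) * _ = 1 - r ^+ N) ?gerBl ?exprn_ge0//.
rewrite -[1 in RHS](expr1n _ N) subrXX; congr (_ * _).
by apply: eq_bigr => i _; rewrite expr1n mul1r.
Qed.

(** * Sums over near-resonances *)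

Lemma ler_powRl (R : realType) (r x y : R) : 0 <= r -> 0 <= x -> x <= y -> x `^ r <= y `^ r.
Proof.
move=> r0 x0 xy; apply: ge0_ler_powR => //; rewrite nnegrE//.
exact: le_trans xy.
Qed.

Lemma powRDp (R : realType) (x r s : R) : 0 < x -> x `^ (r + s) = x `^ r * x `^ s.
Proof. by move=> x0; rewrite powRD// (gt_eqF x0) implybT. Qed.

Lemma powRVK (R : realType) (x r : R) : 0 <= x -> r != 0 -> (x `^ r) `^ r^-1 = x.
Proof. by move=> x0 r0; rewrite -powRrM divff// powRr1. Qed.

Lemma powRVl (R : realType) (x r : R) : 0 <= x -> x^-1 `^ r = (x `^ r)^-1.
Proof. by move=> x0; rewrite -[x^-1]powR_inv1// -powRrM mulN1r powRN. Qed.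

Lemma diophantine_nat (R : realType) (kap x1 x2 : R) : 0 < x1 ->
  diophantine kap (x2 / x1) ->
  exists2 c : R, 0 < c & forall m n : nat, (0 < n)%N ->
    c * n%:R `^ (- kap) <= `|n%:R * x2 - m%:R * x1|.
Proof.
move=> x10 [C C0 HC]; exists (C * x1); first by rewrite mulr_gt0.
move=> m n n0; have nR : (0 : R) < n%:R by rewrite ltr0n.
have := HC (Posz m) (Posz n); rewrite (_ : Posz n != 0) ?eqz_nat -?lt0n// => /(_ isT).
rewrite -!pmulrn normr_nat => h.
have -> : n%:R * x2 - m%:R * x1 = (x1 * n%:R) * (x2 / x1 - m%:R / n%:R).
  by field; rewrite !gt_eqF.
rewrite normrM ger0_norm ?mulr_ge0 ?(ltW x10)//.
have -> : C * x1 * n%:R `^ (- kap) = (x1 * n%:R) * (C * n%:R `^ (- kap - 1)).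
  have -> : n%:R `^ (- kap) = n%:R * n%:R `^ (- kap - 1) :> R.
    rewrite -[X in _ = X * _](powRr1 (ltW nR)) -powRDp//.
    by congr (_ `^ _); ring.
  by ring.
by rewrite ler_pM2l ?mulr_gt0.
Qed.

(** The pair (p1 i, p2 i) determines i and consists of a divisor of m and a divisor of n. *)
Lemma card_factorizations (R : realType) (k : nat) (C X : R) (m n : nat)
    (I : finType) (A : pred I) (p1 p2 : I -> nat) :
  0 <= C ->
  (forall n, (0 < n)%N -> (size (divisors n))%:R <= C * n%:R `^ (k%:R^-1)) ->
  (0 < m)%N -> (0 < n)%N -> m%:R <= X -> n%:R <= X ->
  {in A &, forall i j, p1 i = p1 j -> p2 i = p2 j -> i = j} ->
  (forall i, A i -> (p1 i %| m)%N && (p2 i %| n)%N) ->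
  #|A|%:R <= (C * X `^ (k%:R^-1)) ^+ 2.
Proof.
move=> C0 HC m0 n0 mX nX inj HA.
have X0 : 0 <= X := le_trans (ler0n _ _) mX.
have card : (#|A| <= size (divisors m) * size (divisors n))%N.
  rewrite -(size_allpairs pair) cardE -(size_map (fun i => (p1 i, p2 i))).
  apply: uniq_leq_size.
    rewrite map_inj_in_uniq ?enum_uniq// => i j; rewrite !mem_enum => Ai Aj [].
    exact: inj.
  move=> _ /mapP[i + ->]; rewrite mem_enum => /HA/andP[h1 h2].
  by apply/allpairsP; exists (p1 i, p2 i); rewrite -!dvdn_divisors.
apply: (@le_trans _ _ ((size (divisors m))%:R * (size (divisors n))%:R)).
  by rewrite -natrM ler_nat.
rewrite expr2; apply: ler_pM => //.
- apply: (le_trans (HC _ m0)); rewrite ler_wpM2l//.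
  by apply: ler_powRl; rewrite ?invr_ge0.
- apply: (le_trans (HC _ n0)); rewrite ler_wpM2l//.
  by apply: ler_powRl; rewrite ?invr_ge0.
Qed.

(* The values [n = p2 q1] are separated by [(c / (2 tau)) ^ (1 / kappa)], and each one
   determines [m = p1 q2], hence has [O(X ^ (2 / k))] preimages by the divisor bound. *)
Lemma resonance_sum (R : realType) (x1 x2 kap c : R) (k : nat) :
  0 < x1 -> 0 < x2 -> 0 < c -> 1 <= kap -> (0 < k)%N ->
  (forall m n : nat, (0 < n)%N -> c * n%:R `^ (- kap) <= `|n%:R * x2 - m%:R * x1|) ->
  exists2 C : R, 0 < C &
  forall (I : finType) (P : pred I) (p1 q1 p2 q2 : I -> nat) (X tau : R),
  0 < tau -> 2 * tau < x1 -> 1 <= X ->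
  {in P &, forall i j, p1 i = p1 j -> q1 i = q1 j -> p2 i = p2 j -> q2 i = q2 j -> i = j} ->
  (forall i, P i -> [/\ (0 < p2 i * q1 i)%N, (0 < p1 i * q2 i)%N,
     (p2 i * q1 i)%:R <= X, (p1 i * q2 i)%:R <= X &
     `|(p2 i * q1 i)%:R * x2 - (p1 i * q2 i)%:R * x1| <= tau]) ->
  \sum_(i | P i) ((p2 i * q1 i)%:R)^-1 <= C * (X `^ (k%:R^-1)) ^+ 3 * tau `^ (kap^-1).
Proof.
move=> x10 x20 c0 kap1 k0 dioph.
have kap0 : 0 < kap by lra.
have [C0 C00 HC0] := size_divisors_le R _ k0.
(* The separation [s] below depends on tau; since 2 tau < x1 it is at least [s0], which may enter
   the constant. *)
pose s0 := (c / x1) `^ (kap^-1).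
have s00 : 0 < s0 by rewrite powR_gt0// divr_gt0.
pose C := C0 ^+ 2 * (1 + k%:R) * (s0 `^ (k%:R^-1))^-1 * (2 / c) `^ (kap^-1).
have kR : (0 : R) < k%:R by rewrite ltr0n.
exists C.
  by rewrite /C !mulr_gt0 ?exprn_gt0 ?invr_gt0 ?powR_gt0 ?divr_gt0 ?addr_gt0.
move=> I P p1 q1 p2 q2 X tau tau0 taux X1 inj HP.
have X0 : 0 < X by lra.
pose s := (c / (2 * tau)) `^ (kap^-1).
have ss : s0 <= s.
  apply: ler_powRl; rewrite ?invr_ge0 ?divr_ge0 ?(ltW kap0) ?(ltW c0) ?(ltW x10)//.
  by rewrite ler_pM2l// lef_pV2 ?posrE ?mulr_gt0// ltW.
have s_gt0 : 0 < s := lt_le_trans s00 ss.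
(* Stated with error 2 tau because it is applied to differences of two near-solutions. *)
have sle (m n : nat) : (0 < n)%N -> `|n%:R * x2 - m%:R * x1| <= 2 * tau -> s <= n%:R.
  move=> n0 h; have nR : (0 : R) < n%:R by rewrite ltr0n.
  have := le_trans (dioph m n n0) h.
  rewrite powRN ler_pdivrMr ?powR_gt0// => h1.
  rewrite -[leRHS](powRVK _ _ _ (ltW nR) (lt0r_neq0 kap0)).
  apply: ler_powRl; rewrite ?invr_ge0 ?divr_ge0 ?(ltW kap0) ?(ltW c0) ?mulr_ge0 ?(ltW tau0)//.
  by rewrite ler_pdivrMr ?mulr_gt0// mulrC.
pose N := Num.truncn X.
have NX : N%:R <= X by rewrite truncn_le ltW.
pose B (n : nat) := (0 < n)%N && `[< exists m : nat, `|n%:R * x2 - m%:R * x1| <= tau >].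
have Bs n : B n -> s <= n%:R.
  move=> /andP[n0 /asboolP[m hm]]; apply: (sle m) => //; lra.
have Bsep m n : B m -> B n -> (m < n)%N -> s <= n%:R - m%:R.
  move=> /andP[m0 /asboolP[m' hm]] /andP[n0 /asboolP[n' hn]] mn.
  rewrite -natrB ?(ltnW mn)//.
  (* Numerators grow with n: otherwise the two errors would differ by at least x1 + x2 > 2 tau. *)
  have mn' : (m' <= n')%N.
    rewrite leqNgt; apply/negP => lt.
    have e1 : (n'%:R + 1) * x1 <= m'%:R * x1 by rewrite ler_pM2r// natr1 ler_nat.
    have e2 : (m%:R + 1) * x2 <= n%:R * x2 by rewrite ler_pM2r// natr1 ler_nat.
    move: hm hn e1 e2; rewrite !ler_norml !mulrDl !mul1r => /andP[? ?] /andP[? ?] ? ?.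
    lra.
  apply: (sle (n' - m')%N); first by rewrite subn_gt0.
  rewrite (natrB _ (ltnW mn)) (natrB _ mn').
  rewrite [X in `|X|](_ : _ = (n%:R * x2 - n'%:R * x1) - (m%:R * x2 - m'%:R * x1)); last by ring.
  apply: (le_trans (ler_normB _ _)); lra.
pose D := (C0 * X `^ (k%:R^-1)) ^+ 2.
have D0 : 0 <= D by rewrite exprn_ge0// mulr_ge0 ?powR_ge0 ?(ltW C00).
pose h i := inord (p2 i * q1 i) : 'I_N.+1.
have hE i : P i -> h i = (p2 i * q1 i)%N :> nat.
  by move=> /HP[_ _ h1 _ _]; rewrite inordK// ltnS truncn_ge_nat// ltW.
apply: (@le_trans _ _ (\sum_(n < N.+1 | B n) D * (n%:R)^-1)).
  rewrite (partition_big h (fun n : 'I_N.+1 => B n)) /=; last first.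
    move=> i Pi; rewrite /B hE//; have [-> _ _ _ hi] := HP i Pi.
    by apply/asboolP; exists (p1 i * q2 i)%N.
  apply: ler_sum => n Bn.
  have [n0 _] := andP Bn.
  rewrite (eq_bigr (fun=> (n%:R)^-1)); last first.
    by move=> i /andP[Pi /eqP <-]; rewrite hE.
  rewrite sumr_const -[leLHS]mulr_natl ler_wpM2r ?invr_ge0//.
  case: (pickP [pred i | P i && (h i == n)]) => [i0 /= Ai0|]; last first.
    by move=> A0; rewrite (eq_card A0) card0.
  have [Pi0 /eqP hi0] := andP Ai0.
  have [h1 h2 h3 h4 h5] := HP _ Pi0.
  have hin i : P i && (h i == n) -> (p2 i * q1 i = n)%N.
    by move=> /andP[Pi /eqP <-]; rewrite hE.
  (* Since 2 tau < x1, a given n leaves room for only one m. *)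
  have mE i : P i && (h i == n) -> (p1 i * q2 i = p1 i0 * q2 i0)%N.
    move=> Ai; have [Pi _] := andP Ai; have [g1 g2 g3 g4 g5] := HP _ Pi.
    apply: (@natr_dist_lt1 R).
    rewrite (hin _ Ai) in g5; rewrite (hin _ Ai0) in h5.
    rewrite -(@ltr_pM2r _ x1)// mul1r -[in ltLHS](gtr0_norm x10) -normrM.
    apply: le_lt_trans taux.
    set u := (p1 i * q2 i)%:R in g5 *; set v := (p1 i0 * q2 i0)%:R in h5 *.
    rewrite (_ : (u - v) * x1 = (n%:R * x2 - v * x1) - (n%:R * x2 - u * x1)); last by ring.
    by apply: (le_trans (ler_normB _ _)); lra.
  apply: (card_factorizations _ k C0 X (p1 i0 * q2 i0) n _ _ p1 p2) => //.
  - exact: ltW.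
  - by apply: (le_trans _ NX); rewrite ler_nat -ltnS.
  - move=> i j Ai Aj e1 e2.
    have [Pi _] := andP Ai; have [Pj _] := andP Aj.
    have := hin _ Ai; rewrite -(hin _ Aj) e2 => /eqP.
    have := mE _ Ai; rewrite -(mE _ Aj) e1 => /eqP.
    have [g1 g2 _ _ _] := HP _ Pj.
    move: g1 g2; rewrite !muln_gt0 => /andP[p20 _] /andP[p10 _].
    rewrite !eqn_pmul2l// => /eqP eq2 /eqP eq1.
    exact: inj.
  - by move=> i Ai; rewrite -(mE _ Ai) -(hin _ Ai) !dvdn_mulr.
rewrite -mulr_sumr.
(* Two of the three factors X^(1/k) come from the divisor bound; the third absorbs the logarithm of
   [sep_harmonic]. *)
have -> : C * (X `^ (k%:R^-1)) ^+ 3 * tau `^ (kap^-1) = D * (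
   ((2 / c) `^ (kap^-1) * tau `^ (kap^-1)) *
   ((1 + k%:R) * (X `^ (k%:R^-1) * (s0 `^ (k%:R^-1))^-1))).
  by rewrite /C /D; ring.
rewrite ler_wpM2l//.
have Xs : (X / s0) `^ (k%:R^-1) = X `^ (k%:R^-1) * (s0 `^ (k%:R^-1))^-1.
  by rewrite powRM ?(ltW X0) ?invr_ge0 ?(ltW s00)// powRVl// ltW.
have sV : s^-1 = (2 / c) `^ (kap^-1) * tau `^ (kap^-1).
  rewrite -powRM ?divr_ge0 ?(ltW c0) ?(ltW tau0)//.
  rewrite (_ : 2 / c * tau = (c / (2 * tau))^-1); last by field; rewrite ?gt_eqF.
  have cc : 0 <= c / (2 * tau) by rewrite divr_ge0 ?mulr_ge0// ltW.
  by rewrite powRVl.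
rewrite -sV -Xs.
have [sN|Ns] := leP s N%:R; last first.
  rewrite big1 => [|n Bn].
    by rewrite mulr_ge0 ?invr_ge0 ?(ltW s_gt0)// mulr_ge0 ?powR_ge0// addr_ge0.
  have := lt_le_trans Ns (Bs _ Bn); rewrite ltr_nat.
  by have := ltn_ord n; rewrite ltnS leqNgt => /negbTE ->.
rewrite -(big_mkord B (fun n => (n%:R : R)^-1)).
apply: (le_trans (sep_harmonic _ _ _ _ s_gt0 Bs Bsep sN)).
rewrite ler_pM2l ?invr_gt0//.
apply: (@le_trans _ _ (1 + ln (X / s0))).
  rewrite lerD2l ler_ln ?posrE ?divr_gt0//; last exact: lt_le_trans sN.
  by rewrite ler_pM ?invr_ge0 ?(ltW s_gt0)// lef_pV2.
have := ln_le_powR R (k%:R^-1) (X / s0); rewrite invrK; apply.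
  by rewrite invr_gt0.
by rewrite ler_pdivlMr// mul1r; apply: (le_trans ss); exact: le_trans NX.
Qed.

(** * Pairs of levels *)

(* [u] and [v] are the sizes of the two factors of [alpha]; [q_k / p_k] is a
   rational close to [x_k |xi|]. *)
Definition resonant (R : realType) (x1 x2 tau G M L u v : R) (p1 p2 q1 q2 : nat) : bool :=
  [&& (0 < p1)%N, (0 < p2)%N, p1%:R * u <= M, p2%:R * v <= M,
      q1%:R <= G * p1%:R * L, q2%:R <= G * p2%:R * L &
      `|(p2 * q1)%:R * x2 - (p1 * q2)%:R * x1| <= tau / (u * v)].

(** With X = G M^3 and k = 162, the loss X^(3/k) of [resonance_sum] is M^(1/18) up to a constant. *)
Lemma powR_scale (R : realType) (G M : R) : 0 <= G -> 0 <= M ->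
  ((G * M ^+ 3) `^ (162%:R^-1)) ^+ 3 = (G `^ (162%:R^-1)) ^+ 3 * M `^ (18%:R^-1) :> R.
Proof.
move=> G0 M0; rewrite powRM ?exprn_ge0// exprMn; congr (_ * _).
rewrite -powR_mulrn// -powRrM -powR_mulrn ?powR_ge0// -powRrM; congr (_ `^ _).
by field.
Qed.

(** Since q1 <= G p1 L and p2 v <= M, the weight 1/(M u p1) is at most G L / (u v p2 q1). Then
    [resonance_sum] with error tau/(u v) gives (u v)^(-1 - 1/kap), and 1/kap >= 7/8. *)
Lemma resonant_sum_pos (R : realType) (x1 x2 kap c tau G : R) :
  0 < x1 -> 0 < x2 -> 0 < c -> 1 <= kap < 8 / 7 ->
  (forall m n : nat, (0 < n)%N -> c * n%:R `^ (- kap) <= `|n%:R * x2 - m%:R * x1|) ->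
  0 < tau -> 2 * tau < x1 -> tau < x2 -> 1 <= G ->
  exists2 C : R, 0 < C & forall (M L u v : R) (N : nat),
  1 <= L <= M -> 1 <= u -> 1 <= v ->
  \sum_(t : ('I_N * 'I_N) * ('I_N * 'I_N) |
      resonant _ x1 x2 tau G M L u v t.1.1 t.1.2 t.2.1 t.2.2 && (0 < t.2.1)%N)
    (M * u * t.1.1%:R)^-1
  <= C * (L * M `^ (18%:R^-1) * (u * v) `^ (- (15 / 8))).
Proof.
move=> x10 x20 c0 /andP[kap1 kap8] dioph tau0 taux1 taux2 G1.
have kap0 : 0 < kap by lra.
have [C C0 HC] := resonance_sum _ _ _ _ _ 162 x10 x20 c0 kap1 isT dioph.
have G0 : 0 < G by lra.
exists (G * C * (G `^ (162%:R^-1)) ^+ 3 * tau `^ (kap^-1)).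
  by rewrite !mulr_gt0 ?exprn_gt0 ?powR_gt0.
move=> M L u v N /andP[L1 LM] u1 v1.
have M1 : 1 <= M by exact: le_trans LM.
have [u0 v0 M0 L0] : [/\ 0 < u, 0 < v, 0 < M & 0 < L] by split; lra.
have uv0 : 0 < u * v by rewrite mulr_gt0.
have uv1 : 1 <= u * v by rewrite mulr_ege1.
set P := (X in \sum_(t | X t) _).
(* With q1 > 0, q2 = 0 would give x2 <= p2 q1 x2 <= tau < x2. *)
have HP t : P t -> [/\ (0 < t.1.1)%N, (0 < t.1.2)%N, (0 < t.2.1)%N & (0 < t.2.2)%N].
  move=> /andP[/and5P[p1 p2 _ _ /and3P[_ _ h]] q1]; split => //.
  rewrite lt0n; apply/negP => /eqP q2.
  move: h; rewrite q2 muln0 mul0r subr0 ger0_norm ?mulr_ge0 ?(ltW x20)// => h.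
  have : tau / (u * v) <= tau by rewrite ler_pdivrMr// ler_peMr// ltW.
  have : 1 <= (t.1.2 * t.2.1)%:R :> R by rewrite ler1n muln_gt0 p2.
  move: h; set z := (_ * _)%:R => h z1.
  have : x2 <= z * x2 by rewrite ler_peMl// ltW.
  lra.
apply: (@le_trans _ _ (\sum_(t | P t) G * L / (u * v) * ((t.1.2 * t.2.1)%:R)^-1)).
  apply: ler_sum => t Pt; have [p1 p2 q1 q2] := HP _ Pt.
  move: Pt => /andP[/and5P[_ _ h1 h2 /and3P[h3 _ _]] _].
  have [P1 P2 Q1] : [/\ (0 : R) < t.1.1%:R, (0 : R) < t.1.2%:R & (0 : R) < t.2.1%:R].
    by rewrite !ltr0n.
  rewrite natrM -[_^-1]mul1r ler_pdivrMr ?mulr_gt0//.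
  rewrite [leRHS](_ : _ = (G * t.1.1%:R * L * M) / (v * (t.1.2%:R * t.2.1%:R))); last first.
    by field; rewrite ?gt_eqF.
  rewrite ler_pdivlMr ?mulr_gt0// mul1r.
  rewrite [leLHS](_ : _ = t.2.1%:R * (t.1.2%:R * v)); last by ring.
  by apply: ler_pM => //; rewrite mulr_ge0// ltW.
rewrite -mulr_sumr.
pose tau' := tau / (u * v).
have tau'0 : 0 < tau' by rewrite divr_gt0.
have tau't : tau' <= tau by rewrite ler_pdivrMr// ler_peMr// ltW.
have X1 : 1 <= G * M ^+ 3 by rewrite mulr_ege1// exprn_ege1.
apply: (@le_trans _ _ (G * L / (u * v) * (C * (G * M ^+ 3) `^ 162%:R^-1 ^+ 3 * tau' `^ kap^-1))).
  rewrite ler_wpM2l ?divr_ge0 ?mulr_ge0 ?(ltW G0) ?(ltW L0) ?(ltW uv0) ?(ltW u0) ?(ltW v0)//.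
  apply: (HC _ P (fun t => nat_of_ord t.1.1) (fun t => nat_of_ord t.2.1)
    (fun t => nat_of_ord t.1.2) (fun t => nat_of_ord t.2.2)) => //.
  - lra.
  - move=> [[a1 a2] [a3 a4]] [[b1 b2] [b3 b4]] _ _ /= e1 e2 e3 e4.
    by congr (_, _, (_, _)); apply: ord_inj.
  - move=> t Pt; have [p1 p2 q1 q2] := HP _ Pt.
    move: Pt => /andP[/and5P[_ _ h1 h2 /and3P[h3 h4 h5]] _].
    have pM1 : t.1.1%:R <= M by apply: le_trans h1; rewrite ler_peMr.
    have pM2 : t.1.2%:R <= M by apply: le_trans h2; rewrite ler_peMr.
    split => //; rewrite ?muln_gt0 ?p1 ?p2// natrM.
    - rewrite (_ : G * M ^+ 3 = M * (G * M * M)); last by ring.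
      apply: ler_pM => //; apply: (le_trans h3).
      by apply: ler_pM; rewrite ?mulr_ge0 ?(ltW G0) ?(ltW L0)// ler_pM2l.
    - rewrite (_ : G * M ^+ 3 = M * (G * M * M)); last by ring.
      apply: ler_pM => //; apply: (le_trans h4).
      by apply: ler_pM; rewrite ?mulr_ge0 ?(ltW G0) ?(ltW L0)// ler_pM2l.
rewrite powR_scale ?(ltW G0) ?(ltW M0)// /tau' powRM ?invr_ge0 ?(ltW tau0) ?(ltW uv0)//.
rewrite powRVl ?(ltW uv0)//.
set A := G `^ _ ^+ 3; set B := M `^ _; set D := tau `^ _; set E := _ `^ kap^-1.
rewrite (_ : G * L / (u * v) * (C * (A * B) * (D / E)) =
   G * C * A * D * (L * B * ((u * v)^-1 / E))); last by ring.
have A0 : 0 <= A by rewrite exprn_ge0// powR_ge0.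
rewrite ler_wpM2l ?mulr_ge0 ?powR_ge0 ?(ltW G0) ?(ltW C0)//.
rewrite ler_wpM2l ?mulr_ge0 ?powR_ge0 ?(ltW L0)//.
rewrite -powR_inv1 ?(ltW uv0)// /E -powRN -powRDp//.
apply: ler_powR => //.
have : 7 / 8 <= kap^-1 by rewrite -[kap^-1]mul1r ler_pdivlMr//; lra.
lra.
Qed.

(* The geometric mean of the two bounds on the overlap of two bands avoids the logarithm
   that summing [1 / p1] would cost. *)
Lemma min_le_inv_sqrt (R : rcfType) (a b : R) : 0 < a -> 0 < b ->
  Num.min a^-1 b^-1 <= (Num.sqrt a * Num.sqrt b)^-1.
Proof.
move=> a0 b0.
have m0 : 0 <= Num.min a^-1 b^-1 by rewrite le_min !invr_ge0 !ltW.
rewrite -(@ler_pXn2r _ 2)// ?nnegrE ?invr_ge0 ?mulr_ge0 ?sqrtr_ge0//.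
rewrite exprVn exprMn !sqr_sqrtr ?(ltW a0) ?(ltW b0)// invfM expr2.
by apply: ler_pM; rewrite ?m0 ?ge_min ?lexx ?orbT.
Qed.

(** The condition puts q1 theta within tau/(u v p1 x1) of q2, where theta = p2 x2/(p1 x1), and
    [card_approx] counts such pairs through a Dirichlet approximation a/b of theta. The pair (a, b)
    is returned because it is itself a near-resonance, with error of order 1/L. *)
Lemma resonant_sum_fixed (R : realType) (x1 x2 tau G : R) :
  0 < x1 -> 0 < x2 -> 0 < tau -> 1 <= G ->
  exists2 C : R, 0 < C & forall (M L u v : R) (N : nat) (p1 p2 : nat),
  1 <= L <= M -> 1 <= u -> 1 <= v -> (0 < p1)%N -> (0 < p2)%N ->
  exists a b : nat,
  [/\ (0 < b)%N, b%:R <= C * p1%:R * L, (0 < a)%N,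
     `|(p2 * b)%:R * x2 - (p1 * a)%:R * x1| <= x1 / ((3 + x1 / x2) * L) &
    #|[pred q : 'I_N * 'I_N | resonant _ x1 x2 tau G M L u v p1 p2 q.1 q.2]|%:R <=
      C * (L / (u * v)) + 1 + C * (L * p1%:R / b%:R)].
Proof.
move=> x10 x20 tau0 G1.
have G0 : 0 < G by lra.
(* Dirichlet at height H p1 L gives error x1/(H L). Here H > x1/x2 excludes a = 0, and H >= 3 later
   makes 2 x1/(H L) < x1, as [resonance_sum] requires. *)
pose H := 3 + x1 / x2.
have xx0 : 0 < x1 / x2 by rewrite divr_gt0.
have H3 : 3 <= H by rewrite /H; lra.
have H0 : 0 < H by lra.
(* The first summand collects the terms of order L/(u v), 4 G is the coefficient of L p1/b, and 2 H
   bounds b. *)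
pose C := (16 * G + 8 * H) * tau / x1 + 4 * G + 2 * H.
have T0 : 0 < (16 * G + 8 * H) * tau / x1 by rewrite divr_gt0// mulr_gt0//; lra.
have C0 : 0 < C by rewrite /C; lra.
exists C => // M L u v N p1 p2 /andP[L1 LM] u1 v1 p10 p20.
have [u0 v0 L0] : [/\ 0 < u, 0 < v & 0 < L] by split; lra.
have uv0 : 0 < u * v by rewrite mulr_gt0.
have [P1 P2] : (1 : R) <= p1%:R /\ (1 : R) <= p2%:R by rewrite !ler1n; split.
have [P10 P20] : (0 : R) < p1%:R /\ (0 : R) < p2%:R by split; lra.
have HpL : 1 <= H * p1%:R * L by rewrite !mulr_ege1//; lra.
have GpL : 1 <= G * p1%:R * L by rewrite !mulr_ege1//.
pose theta := p2%:R * x2 / (p1%:R * x1).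
have th0 : 0 < theta by rewrite divr_gt0 ?mulr_gt0.
pose N2 := (Num.truncn (H * p1%:R * L)).+1.
have /andP[n1 n2] : (Num.truncn (H * p1%:R * L))%:R <= H * p1%:R * L < N2%:R.
  by apply: truncn_itv; lra.
have N2le : N2%:R <= 2 * (H * p1%:R * L) by rewrite -[leLHS]natr1; lra.
have [a [b [cab /andP[b0 bN] ab]]] := dirichlet_coprime _ _ N2 isT th0.
have b0R : (0 : R) < b%:R by rewrite ltr0n.
have bN2 : b%:R <= N2%:R :> R by rewrite ler_nat.
have N20 : (0 : R) < N2%:R by rewrite ltr0n.
have val : (p2 * b)%:R * x2 - (p1 * a)%:R * x1 = (p1%:R * x1) * (b%:R * theta - a%:R).
  by rewrite /theta !natrM; field; rewrite !gt_eqF.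
have valb : `|(p2 * b)%:R * x2 - (p1 * a)%:R * x1| <= x1 / (H * L).
  rewrite val normrM gtr0_norm ?mulr_gt0//.
  apply: (@le_trans _ _ (p1%:R * x1 * (H * p1%:R * L)^-1)).
    rewrite ler_pM2l ?mulr_gt0//; apply: (le_trans ab).
    by rewrite lef_pV2 ?posrE ?mulr_gt0// ltW.
  by rewrite le_eqVlt; apply/orP; left; apply/eqP; field; rewrite !gt_eqF.
exists a, b; split => //.
- apply: (le_trans bN2); apply: (le_trans N2le).
  rewrite -!mulrA mulrA ler_pM2r ?mulr_gt0// /C; lra.
- rewrite lt0n; apply/negP => /eqP a0.
  move: valb; rewrite a0 muln0 mul0r subr0 ger0_norm ?mulr_ge0 ?(ltW x20)//.
  apply/negP; rewrite -ltNge.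
  apply: (@lt_le_trans _ _ x2); last first.
    by rewrite ler_peMl ?(ltW x20)// ler1n muln_gt0 p20.
  rewrite ltr_pdivrMr ?mulr_gt0//.
  apply: (@lt_le_trans _ _ (x2 * H)); last by rewrite ler_pM2l// ler_peMr// ltW.
  by rewrite mulrC -ltr_pdivrMr// /H ltrDr.
pose rho := tau / (u * v) / (p1%:R * x1).
have rho0 : 0 <= rho by rewrite !divr_ge0 ?mulr_ge0// ltW.
pose Nq := (Num.truncn (G * p1%:R * L)).+1.
have /andP[m1 m2] : (Num.truncn (G * p1%:R * L))%:R <= G * p1%:R * L < Nq%:R.
  by apply: truncn_itv; lra.
have Nqle : Nq%:R <= 2 * (G * p1%:R * L) by rewrite -[leLHS]natr1; lra.
have abb : `|b%:R * theta - a%:R| <= b%:R^-1.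
  by apply: (le_trans ab); rewrite lef_pV2 ?posrE.
apply: (le_trans (card_approx _ theta rho a b Nq _ _
   (fun q : 'I_N * 'I_N => nat_of_ord q.1) (fun q => nat_of_ord q.2) cab b0 abb rho0 _ _)).
- by move=> [a1 a2] [b1 b2] _ _ /= e1 e2; congr (_, _); apply: ord_inj.
- move=> q /and5P[_ _ _ _ /and3P[h3 h4 h5]]; split.
    by rewrite -(ltr_nat R); apply: le_lt_trans m2.
  rewrite /rho ler_pdivlMr ?mulr_gt0//.
  rewrite -[X in _ * X](@gtr0_norm _ (p1%:R * x1)) ?mulr_gt0// -normrM.
  apply: le_trans h5; rewrite le_eqVlt; apply/orP; left; apply/eqP; congr (`|_|).
  by rewrite /theta !natrM; field; rewrite !gt_eqF.
have e1 : 2 * Nq%:R / b%:R + 1 <= 4 * (G * p1%:R * L) / b%:R + 1.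
  by rewrite lerD2r ler_pM2r ?invr_gt0//; lra.
have rb0 : 0 <= 4 * rho * b%:R + 1 by rewrite addr_ge0// mulr_ge0// mulr_ge0.
apply: (le_trans (ler_wpM2r rb0 e1)).
have e2 : rho * b%:R <= 2 * H * tau / x1 * (L / (u * v)).
  apply: (@le_trans _ _ (rho * (2 * (H * p1%:R * L)))).
    by rewrite ler_wpM2l// (le_trans bN2).
  by rewrite /rho le_eqVlt; apply/orP; left; apply/eqP; field; rewrite !gt_eqF.
rewrite [leLHS](_ : _ = 16 * G * tau / x1 * (L / (u * v)) + 4 * (rho * b%:R) + 1
   + 4 * G * (L * p1%:R / b%:R)); last first.
  by rewrite /rho; field; rewrite !gt_eqF.
have Y0 : 0 <= L / (u * v) by rewrite divr_ge0// ltW.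
have Z0 : 0 <= L * p1%:R / b%:R by rewrite divr_ge0// mulr_ge0// ltW.
set Y := L / (u * v) in e2 Y0 *; set Z := L * _ / _ in Z0 *.
have Cc1 : 16 * G * tau / x1 + 4 * (2 * H * tau / x1) <= C.
  rewrite /C (_ : _ + _ = (16 * G + 8 * H) * tau / x1); last by field; rewrite gt_eqF.
  by lra.
have Cc2 : 4 * G <= C by rewrite /C; lra.
have f1 := ler_wpM2r Y0 Cc1.
have f2 := ler_wpM2r Z0 Cc2.
rewrite mulrDl in f1; lra.
Qed.

(** This is [sum_inv_sqrt_le] at Y = M/u, as (M u)^(-1/2) (M/u)^(1/2) = 1/u. *)
Lemma sum_inv_sqrt_scaled_le (R : realType) (N : nat) (M u : R) : 0 < M -> 0 < u ->
  \sum_(p < N | (0 < p)%N && (p%:R * u <= M)) (Num.sqrt (M * u * p%:R))^-1 <= 2 / u.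
Proof.
move=> M0 u0; have Mu0 : 0 < M * u by rewrite mulr_gt0.
rewrite (eq_bigr (fun p : 'I_N => (Num.sqrt (M * u))^-1 * (Num.sqrt p%:R)^-1)); last first.
  by move=> p _; rewrite sqrtrM ?(ltW Mu0)// invfM.
rewrite -mulr_sumr (eq_bigl (fun p : 'I_N => (0 < p)%N && (p%:R <= M / u))); last first.
  by move=> p; rewrite ler_pdivlMr.
have Y0 : 0 <= M / u by rewrite divr_ge0// ltW.
apply: (le_trans (ler_wpM2l _ (sum_inv_sqrt_le _ N _ Y0))).
  by rewrite invr_ge0 sqrtr_ge0.
rewrite mulrCA ler_pM2l// -sqrtrV ?(ltW Mu0)// -sqrtrM ?invr_ge0 ?(ltW Mu0)//.
rewrite (_ : (M * u)^-1 * (M / u) = u^-1 ^+ 2); last by field; rewrite !gt_eqF.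
by rewrite sqrtr_sqr ger0_norm// invr_ge0 ltW.
Qed.

(** Summing over q1, q2 first keeps the leading term L (u v)^-2 free of powers of M. Against the
    weight, the terms L p1/b become multiples of 1/(p2 b) over near-resonances of error x1/(H L),
    where [resonance_sum] saves L^(-7/8). *)
Lemma resonant_sum_all (R : realType) (x1 x2 kap c tau G : R) :
  0 < x1 -> 0 < x2 -> 0 < c -> 1 <= kap < 8 / 7 ->
  (forall m n : nat, (0 < n)%N -> c * n%:R `^ (- kap) <= `|n%:R * x2 - m%:R * x1|) ->
  0 < tau -> 1 <= G ->
  exists2 C : R, 0 < C & forall (M L u v : R) (N : nat),
  1 <= L <= M -> 1 <= u -> 1 <= v ->
  \sum_(t : ('I_N * 'I_N) * ('I_N * 'I_N) |
      resonant _ x1 x2 tau G M L u v t.1.1 t.1.2 t.2.1 t.2.2)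
    Num.min (M * u * t.1.1%:R)^-1 (M * v * t.1.2%:R)^-1
  <= C * (L * (u * v) `^ (- 2) + M `^ (18%:R^-1) * L `^ (8%:R^-1) * (u * v) `^ (-1)).
Proof.
move=> x10 x20 c0 /andP[kap1 kap8] dioph tau0 G1.
have kap0 : 0 < kap by lra.
have [C1 C10 HC1] := resonant_sum_fixed _ _ _ _ _ x10 x20 tau0 G1.
have [C2 C20 HC2] := resonance_sum _ _ _ _ _ 162 x10 x20 c0 kap1 isT dioph.
pose H := 3 + x1 / x2.
have xx0 : 0 < x1 / x2 by rewrite divr_gt0.
have H0 : 0 < H by rewrite /H; lra.
(* K M^3 dominates p2 b, which is at most C1 M^3, and also p1 a, because p1 a x1 <= p2 b x2 + x1. *)
pose K := C1 * (1 + x2 / x1) + 1.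
have xx0' : 0 < x2 / x1 by rewrite divr_gt0.
have K0 : 0 < K by rewrite /K addr_gt0// mulr_gt0// addr_gt0.
pose C3 := C2 * (K `^ (162%:R^-1)) ^+ 3 * (x1 / H) `^ (kap^-1).
have C30 : 0 < C3 by rewrite /C3 !mulr_gt0 ?exprn_gt0 ?powR_gt0 ?divr_gt0.
exists (4 * C1 + 4 + C1 * C3); first by have := mulr_gt0 C10 C30; lra.
move=> M L u v N /andP[L1 LM] u1 v1.
have M1 : 1 <= M by exact: le_trans LM.
have [u0 v0 M0 L0] : [/\ 0 < u, 0 < v, 0 < M & 0 < L] by split; lra.
have uv0 : 0 < u * v by rewrite mulr_gt0.
have uv1 : 1 <= u * v by rewrite mulr_ege1.
pose Pp (p : 'I_N * 'I_N) := ((0 < p.1)%N && (p.1%:R * u <= M)) &&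
                             ((0 < p.2)%N && (p.2%:R * v <= M)).
pose Q (p q : 'I_N * 'I_N) := resonant _ x1 x2 tau G M L u v p.1 p.2 q.1 q.2.
pose w (p : 'I_N * 'I_N) := Num.min (M * u * p.1%:R)^-1 (M * v * p.2%:R)^-1.
have /choice [f Hf] : forall p : 'I_N * 'I_N, exists ab : nat * nat, Pp p ->
   [/\ (0 < ab.2)%N, ab.2%:R <= C1 * p.1%:R * L, (0 < ab.1)%N,
     `|(p.2 * ab.2)%:R * x2 - (p.1 * ab.1)%:R * x1| <= x1 / (H * L) &
    #|[pred q : 'I_N * 'I_N | Q p q]|%:R <=
      C1 * (L / (u * v)) + 1 + C1 * (L * p.1%:R / ab.2%:R)].
  move=> p; have [Pp'|nPp] := boolP (Pp p); last by exists (0, 0)%N.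
  move: Pp' => /andP[/andP[p10 _] /andP[p20 _]].
  have [|a [b Hab]] := HC1 M L u v N p.1 p.2 _ u1 v1 p10 p20; first by rewrite L1.
  by exists (a, b).
rewrite (eq_bigl (fun t => Pp t.1 && Q t.1 t.2)); last first.
  move=> t; rewrite /Pp /Q /resonant; case: (0 < t.1.1)%N; case: (0 < t.1.2)%N => //=.
    by case: (_ <= M); case: (_ <= M).
  by rewrite andbF.
rewrite -(pair_big_dep Pp Q (fun p q => w p)) /=.
have w0 p : 0 <= w p by rewrite le_min !invr_ge0 !mulr_ge0// ltW.
have uvV0 : 0 <= (u * v)^-1 by rewrite invr_ge0 ltW.
apply: (@le_trans _ _ (\sum_(p | Pp p) ((C1 * (L / (u * v)) + 1) * w p +
    C1 * (L / (u * v)) * ((p.2 * (f p).2)%:R)^-1))).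
  apply: ler_sum => p Ppp; have [h1 h2 h3 h4 h5] := Hf _ Ppp.
  move: (Ppp) => /andP[/andP[p10 p1M] /andP[p20 p2M]].
  have [P10 P20 B0] : [/\ (0 : R) < p.1%:R, (0 : R) < p.2%:R & (0 : R) < (f p).2%:R].
    by rewrite !ltr0n.
  rewrite sumr_const -[leLHS]mulr_natl.
  apply: (le_trans (ler_wpM2r (w0 p) h5)).
  rewrite mulrDl lerD2l -!mulrA ler_pM2l//.
  (* Bounding the minimum by its first entry cancels p1; then M >= p2 v turns L/(M u b) into at most
     L/(u v p2 b). *)
  apply: (@le_trans _ _ (L * (p.1%:R * ((f p).2%:R^-1 * (M * u * p.1%:R)^-1)))).
    rewrite ler_pM2l// ler_pM2l// ler_pM2l ?invr_gt0//.
    by rewrite ge_min lexx.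
  rewrite ler_pM2l// natrM.
  rewrite (_ : p.1%:R * _ = (u * (f p).2%:R * M)^-1); last by field; rewrite !gt_eqF.
  rewrite -invfM lef_pV2 ?posrE ?mulr_gt0//.
  rewrite (_ : u * v * _ = u * (f p).2%:R * (p.2%:R * v)); last by ring.
  by rewrite ler_pM2l ?mulr_gt0.
rewrite big_split /= -!mulr_sumr.
(* The square roots decouple p1 from p2, leaving a product of sums at most 2/u and 2/v. *)
have S1 : \sum_(p | Pp p) w p <= 4 / (u * v).
  apply: (@le_trans _ _ (\sum_(p | Pp p) (Num.sqrt (M * u * p.1%:R))^-1 *
       (Num.sqrt (M * v * p.2%:R))^-1)).
    apply: ler_sum => p /andP[/andP[p10 _] /andP[p20 _]]; rewrite -invfM.
    by apply: min_le_inv_sqrt; rewrite !mulr_gt0 ?ltr0n.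
  rewrite -(pair_big_dep (fun p1 : 'I_N => (0 < p1)%N && (p1%:R * u <= M))
     (fun _ (p2 : 'I_N) => (0 < p2)%N && (p2%:R * v <= M))
     (fun p1 p2 => (Num.sqrt (M * u * p1%:R))^-1 * (Num.sqrt (M * v * p2%:R))^-1)) /=.
  rewrite -big_distrlr /=.
  rewrite (_ : 4 / (u * v) = (2 / u) * (2 / v)); last by field; rewrite !gt_eqF.
  by apply: ler_pM; rewrite ?sum_inv_sqrt_scaled_le// sumr_ge0// => p _;
     rewrite invr_ge0 sqrtr_ge0.
have t0 : 0 < x1 / (H * L) by rewrite divr_gt0 ?mulr_gt0.
have KM1 : 1 <= K * M ^+ 3.
  by rewrite mulr_ege1 ?exprn_ege1// /K lerDr mulr_ge0 ?addr_ge0// ltW.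
have S2 : \sum_(p | Pp p) ((p.2 * (f p).2)%:R)^-1 <= C3 * (M `^ (18%:R^-1) * L `^ (- (7 / 8))).
  apply: (@le_trans _ _ (C2 * (K * M ^+ 3) `^ 162%:R^-1 ^+ 3 * (x1 / (H * L)) `^ kap^-1)).
    apply: (HC2 _ Pp (fun p => nat_of_ord p.1) (fun p => (f p).2)
       (fun p => nat_of_ord p.2) (fun p => (f p).1)) => //.
    - rewrite mulrA ltr_pdivrMr ?mulr_gt0// mulrC ltr_pM2l//.
      have : H <= H * L by rewrite ler_peMr// ltW.
      rewrite /H; lra.
    - by move=> [a1 a2] [b1 b2] _ _ /= e1 _ e2 _; congr (_, _); apply: ord_inj.
    - move=> p Ppp; have [h1 h2 h3 h4 h5] := Hf _ Ppp.
      move: (Ppp) => /andP[/andP[p10 p1M] /andP[p20 p2M]].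
      have pM1 : p.1%:R <= M by apply: le_trans p1M; rewrite ler_peMr.
      have pM2 : p.2%:R <= M by apply: le_trans p2M; rewrite ler_peMr.
      have bnd : (p.2 * (f p).2)%:R <= C1 * M ^+ 3.
        rewrite natrM (_ : C1 * M ^+ 3 = M * (C1 * M * M)); last by ring.
        apply: ler_pM => //; apply: (le_trans h2).
        by apply: ler_pM; rewrite ?mulr_ge0 ?(ltW C10) ?(ltW L0)// ler_pM2l.
      have M31 : 1 <= M ^+ 3 by rewrite exprn_ege1.
      have M30 : 0 < M ^+ 3 by lra.
      split => //; rewrite ?muln_gt0 ?p10 ?p20//.
      + apply: (le_trans bnd); rewrite ler_pM2r// /K mulrDr mulr1 -addrA lerDl.
        by rewrite addr_ge0// mulr_ge0// ltW.
      + have : x1 / (H * L) <= x1.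
          rewrite ler_pdivrMr ?mulr_gt0// ler_peMr ?(ltW x10)//.
          by rewrite mulr_ege1// /H; lra.
        move: h4; rewrite ler_norml => /andP[h4 _] hx.
        rewrite -(ler_pM2r x10).
        have := ler_wpM2r (ltW x20) bnd.
        have -> : K * M ^+ 3 * x1 = C1 * M ^+ 3 * x1 + C1 * M ^+ 3 * x2 + M ^+ 3 * x1.
          by rewrite /K; field; rewrite gt_eqF.
        have := ler_wpM2r (ltW x10) M31.
        have : 0 <= C1 * M ^+ 3 * x1 by rewrite !mulr_ge0// ltW.
        rewrite mul1r; lra.
  rewrite powR_scale ?(ltW K0) ?(ltW M0)//.
  rewrite (_ : x1 / (H * L) = (x1 / H) * L^-1); last by field; rewrite !gt_eqF.
  rewrite powRM ?invr_ge0 ?divr_ge0 ?(ltW x10) ?(ltW H0) ?(ltW L0)//.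
  set A := K `^ _ ^+ 3; set B := M `^ _; set D := _ `^ kap^-1; set E := _ `^ kap^-1.
  rewrite (_ : C2 * _ * _ = C2 * A * D * (B * E)); last by ring.
  rewrite /C3 ler_wpM2l ?mulr_ge0 ?exprn_ge0 ?powR_ge0 ?(ltW C20)//.
  rewrite ler_wpM2l ?powR_ge0//.
  rewrite /E powRVl ?(ltW L0)// -powRN ler_powR//.
  have : 7 / 8 <= kap^-1 by rewrite -[kap^-1]mul1r ler_pdivlMr//; lra.
  lra.
have a0 : 0 <= C1 * (L / (u * v)) + 1.
  by rewrite addr_ge0// mulr_ge0 ?divr_ge0// ltW.
have b0 : 0 <= C1 * (L / (u * v)) by rewrite mulr_ge0 ?divr_ge0// ltW.
apply: (le_trans (lerD (ler_wpM2l a0 S1) (ler_wpM2l b0 S2))).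
rewrite !powR_inv1 ?(ltW uv0)//.
have -> : (u * v) `^ (- 2) = ((u * v)^-1) ^+ 2.
  by rewrite powRN -[2]/(2%:R) powR_mulrn ?(ltW uv0)// exprVn.
have LL : L * L `^ (- (7 / 8)) = L `^ (8^-1).
  rewrite -{1}(powRr1 (ltW L0)) -powRDp//; congr (_ `^ _); lra.
set iuv := (u * v)^-1 in uvV0 *; set m := M `^ _; set l := L `^ (8%:R^-1).
have m1 : 1 <= m by rewrite -(powRr0 M); apply: ler_powR.
have l1 : 1 <= l by rewrite -(powRr0 L); apply: ler_powR.
rewrite [leLHS](_ : _ = 4 * C1 * (L * iuv ^+ 2) + 4 * iuv +
  C1 * C3 * (m * (L * L `^ (- (7/8))) * iuv)); last by ring.
rewrite LL -/l.
have z1 : 0 <= L * iuv ^+ 2 by rewrite mulr_ge0 ?exprn_ge0// ltW.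
have z2 : iuv <= m * l * iuv by rewrite ler_peMl// mulr_ege1.
have z3 : 0 <= m * l * iuv by exact: le_trans z2.
have z4 : 0 <= C1 * C3 by rewrite mulr_ge0 ?ltW.
set Z1 := L * iuv ^+ 2 in z1 *; set Z2 := m * l * iuv in z2 z3 *.
have := mulr_ge0 (ltW C10) z3; have := mulr_ge0 z4 z1.
rewrite !mulrDr !mulrDl; set Y1 := _ * Z2; lra.
Qed.

Lemma powR_expR (R : realType) (a r : R) : (expR a) `^ r = expR (r * a).
Proof. by rewrite /powR gt_eqF ?expR_gt0// expRK. Qed.

(* Exponents: [13 / 12] is [beta], and the three cases are [M ^ (4/18) <= u] (first
   hypothesis), then [M ^ (8/18) <= L] (second hypothesis), then the term [M ^ (1 - delta)]. *)
Lemma level_bound (R : realType) (C1 C2 S M L u v delta : R) :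
  0 <= C1 -> 0 <= C2 -> 1 <= L <= M -> 1 <= v <= u -> delta < 2^-1 ->
  S <= C1 * (L * M `^ (18%:R^-1) * (u * v) `^ (- (15 / 8))) ->
  S <= C2 * (L * (u * v) `^ (- 2) + M `^ (18%:R^-1) * L `^ (8%:R^-1) * (u * v) `^ (-1)) ->
  u `^ (13 / 12) * v `^ (13 / 6) * S
  <= (C1 + 2 * C2) * ((L + M `^ (1 - delta)) * (u * v) `^ (- 8%:R^-1)).
Proof.
move=> C10 C20 /andP[L1 LM] /andP[v1 vu] d2 S1 S2.
have [u0 v0 L0 M0] : [/\ 0 < u, 0 < v, 0 < L & 0 < M] by split; lra.
(* In logarithmic coordinates the comparisons of monomials become linear inequalities. *)
have [U uE] : exists U, u = expR U by exists (ln u); rewrite lnK.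
have [V vE] : exists V, v = expR V by exists (ln v); rewrite lnK.
have [l LE] : exists l, L = expR l by exists (ln L); rewrite lnK.
have [m ME] : exists m, M = expR m by exists (ln M); rewrite lnK.
subst u v L M.
rewrite !ler_expR in LM vu.
have l0 : 0 <= l by rewrite -(expRK l) ln_ge0.
have V0 : 0 <= V by rewrite -(expRK V) ln_ge0.
move: S1 S2; rewrite -!expRD !powR_expR -!expRD => S1 S2.
have E0 : 0 <= expR (13 / 12 * U + 13 / 6 * V) by exact: expR_ge0.
rewrite [X in _ <= _ * X]mulrDl -!expRD.
have h1 := ler_wpM2l E0 S1; have h2 := ler_wpM2l E0 S2.
rewrite mulrCA -expRD in h1; rewrite mulrCA mulrDr -!expRD in h2.
set Q1 := expR (l + _); set Q2 := expR ((1 - delta) * m + _).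
have Q10 : 0 <= Q1 by exact: expR_ge0.
have Q20 : 0 <= Q2 by exact: expR_ge0.
have C1Q1 := mulr_ge0 C10 Q10; have C1Q2 := mulr_ge0 C10 Q20.
have C2Q1 := mulr_ge0 C20 Q10; have C2Q2 := mulr_ge0 C20 Q20.
have md : delta * m <= 2^-1 * m by rewrite ler_wpM2r; lra.
rewrite [leRHS]mulrDl !mulrDr.
have [Um|Um] := leP (4 / 18 * m) U.
  apply: (le_trans h1); apply: (@le_trans _ _ (C1 * Q1)); last by lra.
  by rewrite ler_wpM2l// ler_expR; lra.
have [lm8|lm8] := leP (8 / 18 * m) l.
  apply: (le_trans h2); apply: (@le_trans _ _ (C2 * (Q1 + Q1))); last by lra.
  by rewrite ler_wpM2l// lerD// ler_expR; lra.
apply: (le_trans h1); apply: (@le_trans _ _ (C1 * Q2)); last by lra.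
by rewrite ler_wpM2l// ler_expR; lra.
Qed.

(* The bound on [u] is what the cutoff [M ^ (-1 - eta) < |xi|] gives for the row [(1, 0)]. *)
Lemma zero_level_bound (R : realType) (G M u v : R) :
  1 <= G -> 1 <= M -> 1 <= v <= u -> u <= G * M `^ (3^-1) ->
  u `^ (13 / 12) * v `^ (13 / 6) * (M * u)^-1 <= G `^ 3 * (u * v) `^ (- 8%:R^-1).
Proof.
move=> G1 M1 /andP[v1 vu] uG.
have [u0 v0 G0 M0] : [/\ 0 < u, 0 < v, 0 < G & 0 < M] by split; lra.
have [U uE] : exists U, u = expR U by exists (ln u); rewrite lnK.
have [V vE] : exists V, v = expR V by exists (ln v); rewrite lnK.
have [g GE] : exists g, G = expR g by exists (ln G); rewrite lnK.
have [m ME] : exists m, M = expR m by exists (ln M); rewrite lnK.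
subst u v G M.
move: uG; rewrite powR_expR -!expRD !powR_expR -expRN -!expRD !ler_expR.
rewrite ler_expR in vu.
have V0 : 0 <= V by rewrite -(expRK V) ln_ge0.
lra.
Qed.

Lemma card_natr_le (R : realType) (N : nat) (Y : R) : 0 <= Y ->
  #|[pred q : 'I_N | q%:R <= Y]|%:R <= Y + 1.
Proof.
move=> Y0; have /andP[t1 t2] := truncn_itv Y0.
have : (#|[pred q : 'I_N | (q%:R <= Y :> R)%R]| <= (Num.truncn Y).+1)%N.
  pose f (q : 'I_N) : 'I_(Num.truncn Y).+1 := inord q.
  rewrite -(card_in_imset (f := f)); first by rewrite -[X in (_ <= X)%N]card_ord max_card.
  have h (q : 'I_N) : q%:R <= Y -> (q < (Num.truncn Y).+1)%N.
    by move=> qY; rewrite ltnS truncn_ge_nat.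
  move=> p q; rewrite !inE => /h pY /h qY /(congr1 val) /=; rewrite !inordK// => e.
  exact: ord_inj.
by rewrite -(ler_nat R) => /le_trans; apply; rewrite -natr1 lerD2r.
Qed.

Lemma card_posnatr_le (R : realType) (N : nat) (Y : R) : 0 <= Y ->
  #|[pred p : 'I_N | (0 < p)%N && (p%:R <= Y)]|%:R <= Y.
Proof.
move=> Y0.
have : (#|[pred p : 'I_N | (0 < p)%N && (p%:R <= Y :> R)%R]| <= Num.truncn Y)%N.
  pose f (q : 'I_N) : 'I_(Num.truncn Y).+1 := inord q.
  have h (q : 'I_N) : q%:R <= Y -> (q < (Num.truncn Y).+1)%N.
    by move=> qY; rewrite ltnS truncn_ge_nat.
  rewrite -(card_in_imset (f := f)); last first.
    move=> p q; rewrite !inE => /andP[_ /h pY] /andP[_ /h qY] /(congr1 val) /=.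
    by rewrite !inordK// => e; exact: ord_inj.
  rewrite -ltnS -[X in (_ < X)%N]card_ord -cardsT; apply: proper_card.
  apply/fintype.properP; split; first by apply/fintype.subsetP => z _; rewrite finset.in_setT.
  exists ord0 => //; apply/imsetP => -[p]; rewrite inE => /andP[p0 /h pY].
  by move=> /(congr1 val) /=; rewrite inordK// => e; rewrite -e in p0.
by rewrite -(ler_nat R) => /le_trans; apply; rewrite truncn_le.
Qed.

(** Each p has O(G p L) numerators q of weight 1/(M u p), so p cancels, and at most M/u values of p
    remain. This serves the points where only one factor is large. *)
Lemma single_level_sum (R : realType) (G M L u : R) (N : nat) :
  1 <= G -> 1 <= L -> 1 <= M -> 1 <= u ->
  \sum_(t : 'I_N * 'I_N | [&& (0 < t.1)%N, t.1%:R * u <= M & t.2%:R <= G * t.1%:R * L])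
    (M * u * t.1%:R)^-1 <= 2 * G * L / u ^+ 2.
Proof.
move=> G1 L1 M1 u1.
have [G0 L0 M0 u0] : [/\ 0 < G, 0 < L, 0 < M & 0 < u] by split; lra.
rewrite (eq_bigl (fun t : 'I_N * 'I_N => ((0 < t.1)%N && (t.1%:R <= M / u)) &&
    (t.2%:R <= G * t.1%:R * L))); last first.
  by move=> t; rewrite ler_pdivlMr// andbA.
rewrite -(pair_big_dep (fun p : 'I_N => (0 < p)%N && (p%:R <= M / u))
  (fun (p q : 'I_N) => q%:R <= G * p%:R * L) (fun p _ => (M * u * p%:R)^-1)) /=.
apply: (@le_trans _ _ (\sum_(p < N | (0 < p)%N && (p%:R <= M / u)) 2 * G * L / (M * u))).
  apply: ler_sum => p /andP[p0 _].
  have P0 : (1 : R) <= p%:R by rewrite ler1n.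
  have P0' : (0 : R) < p%:R by lra.
  have g1 : 1 <= G * p%:R * L by rewrite !mulr_ege1.
  have g0 : 0 <= G * p%:R * L by lra.
  rewrite sumr_const -[leLHS]mulr_natl.
  apply: (@le_trans _ _ (2 * (G * p%:R * L) * (M * u * p%:R)^-1)).
    rewrite ler_pM2r ?invr_gt0 ?mulr_gt0//.
    by apply: (le_trans (card_natr_le _ N _ g0)); lra.
  by rewrite le_eqVlt; apply/orP; left; apply/eqP; field; rewrite !gt_eqF.
rewrite sumr_const -[leLHS]mulr_natl.
have Mu : 0 <= M / u by rewrite divr_ge0// ltW.
apply: (@le_trans _ _ (M / u * (2 * G * L / (M * u)))).
  rewrite ler_pM2r; first exact: card_posnatr_le.
  by rewrite divr_gt0// !mulr_gt0.
by rewrite le_eqVlt; apply/orP; left; apply/eqP; field; rewrite !gt_eqF.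
Qed.

(** The second alternative is the degenerate case q1 = 0: then q2 = 0, both rows are (1, 0) up to
    sign, and the cutoff on |xi| limits u. *)
Definition resonant_pair (R : realType) (x1 x2 tau G M L u v : R) (p1 p2 q1 q2 : nat) :=
  resonant _ x1 x2 tau G M L u v p1 p2 q1 q2 &&
  ((0 < q1)%N || [&& p1 == 1%N, p2 == 1%N, q1 == 0%N, q2 == 0%N & u <= G * M `^ (3^-1)]).

(** The part q1 > 0 obeys both resonant sum bounds, which [level_bound] combines. What remains is at
    most the single term p1 = p2 = 1, q1 = q2 = 0, treated by [zero_level_bound]. *)
Lemma pair_level_sum (R : realType) (x1 x2 kap c tau G : R) :
  0 < x1 -> 0 < x2 -> 0 < c -> 1 <= kap < 8 / 7 ->
  (forall m n : nat, (0 < n)%N -> c * n%:R `^ (- kap) <= `|n%:R * x2 - m%:R * x1|) ->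
  0 < tau -> 2 * tau < x1 -> tau < x2 -> 1 <= G ->
  exists2 C : R, 0 < C & forall (M L u v delta : R) (N : nat),
  1 <= L <= M -> 1 <= v <= u -> delta < 2^-1 ->
  u `^ (13 / 12) * v `^ (13 / 6) *
  \sum_(t : ('I_N * 'I_N) * ('I_N * 'I_N) |
      resonant_pair _ x1 x2 tau G M L u v t.1.1 t.1.2 t.2.1 t.2.2)
    Num.min (M * u * t.1.1%:R)^-1 (M * v * t.1.2%:R)^-1
  <= C * ((L + M `^ (1 - delta)) * (u * v) `^ (- 8%:R^-1)).
Proof.
move=> x10 x20 c0 hk dioph tau0 taux1 taux2 G1.
have [C1 C10 HC1] := resonant_sum_pos _ _ _ _ _ _ _ x10 x20 c0 hk dioph tau0 taux1 taux2 G1.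
have [C2 C20 HC2] := resonant_sum_all _ _ _ _ _ _ _ x10 x20 c0 hk dioph tau0 G1.
have G0 : 0 < G by lra.
exists (C1 + 2 * C2 + G `^ 3); first by rewrite addr_gt0 ?powR_gt0//; lra.
move=> M L u v delta N LM /andP[v1 vu] d2.
have u1 : 1 <= u by exact: le_trans vu.
have /andP[L1 LM'] := LM; have M1 : 1 <= M by exact: le_trans LM'.
have [u0 v0 L0 M0] : [/\ 0 < u, 0 < v, 0 < L & 0 < M] by split; lra.
set w := fun t : ('I_N * 'I_N) * ('I_N * 'I_N) =>
  Num.min (M * u * t.1.1%:R)^-1 (M * v * t.1.2%:R)^-1.
have w0 t : 0 <= w t by rewrite le_min !invr_ge0 !mulr_ge0// ltW.
pose P1 (t : ('I_N * 'I_N) * ('I_N * 'I_N)) :=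
  resonant _ x1 x2 tau G M L u v t.1.1 t.1.2 t.2.1 t.2.2 && (0 < t.2.1)%N.
pose P2 (t : ('I_N * 'I_N) * ('I_N * 'I_N)) :=
  [&& t.1.1 == 1%N :> nat, t.1.2 == 1%N :> nat, t.2.1 == 0%N :> nat, t.2.2 == 0%N :> nat
    & u <= G * M `^ (3^-1)].
set S := \sum_(t | _) _.
have S12 : S <= \sum_(t | P1 t) w t + \sum_(t | P2 t) w t.
  rewrite /S [X in X + _]big_mkcond [X in _ + X]big_mkcond [leLHS]big_mkcond -big_split /=.
  apply: ler_sum => t _; rewrite /resonant_pair /P1 /P2.
  case: (resonant _ _ _ _ _ _ _ _ _ _ _ _ _) => /=; last by rewrite add0r; case: ifP.
  case: (0 < _)%N => /=; last by rewrite add0r.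
  by rewrite lerDl; case: ifP.
set S1 := \sum_(t | P1 t) w t in S12 *; set S2 := \sum_(t | P2 t) w t in S12 *.
have b1 : S1 <= C1 * (L * M `^ (18%:R^-1) * (u * v) `^ (- (15 / 8))).
  apply: le_trans (HC1 M L u v N LM u1 v1); apply: ler_sum => t _.
  by rewrite ge_min lexx.
have b2 : S1 <= C2 * (L * (u * v) `^ (- 2) + M `^ (18%:R^-1) * L `^ (8%:R^-1) * (u * v) `^ (-1)).
  apply: le_trans (HC2 M L u v N LM u1 v1).
  rewrite /S1 big_mkcondr; apply: ler_sum => t _; case: ifP => // _; exact: w0.
have E0 : 0 <= u `^ (13 / 12) * v `^ (13 / 6) by rewrite mulr_ge0 ?powR_ge0.
apply: (le_trans (ler_wpM2l E0 S12)); rewrite mulrDr [leRHS]mulrDl; apply: lerD.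
  by apply: level_bound => //; rewrite ?(ltW C10) ?(ltW C20) ?v1.
have B0 : 0 <= (u * v) `^ (- 8%:R^-1) by exact: powR_ge0.
have Lm1 : 1 <= L + M `^ (1 - delta) by have := powR_ge0 M (1 - delta); lra.
have [uG|uG] := leP u (G * M `^ (3^-1)); last first.
  rewrite /S2 big1 ?mulr0; last by move=> t /and5P[_ _ _ _]; rewrite leNgt uG.
  by rewrite !mulr_ge0 ?powR_ge0//; lra.
have S2b : S2 <= (M * u)^-1.
  rewrite /S2; case: (pickP P2) => [t0 Pt0|P20]; last first.
    by rewrite big_pred0// invr_ge0 mulr_ge0 ?(ltW M0) ?(ltW u0).
  rewrite (bigD1 t0)//= big1 ?addr0 => [|t /andP[Pt /eqP []]].
    have /and5P[/eqP e _ _ _ _] := Pt0.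
    by rewrite ge_min; apply/orP; left; rewrite e mulr1.
  have /and5P[/eqP e1 /eqP e2 /eqP e3 /eqP e4 _] := Pt0.
  move: Pt => /and5P[/eqP f1 /eqP f2 /eqP f3 /eqP f4 _].
  move: t t0 e1 e2 e3 e4 f1 f2 f3 f4 {Pt0} => [[t1 t2] [t3 t4]] [[s1 s2] [s3 s4]] /=.
  move=> e1 e2 e3 e4 f1 f2 f3 f4.
  by congr (_, _, (_, _)); apply: ord_inj; congruence.
apply: (le_trans (ler_wpM2l E0 S2b)).
have vu' : 1 <= v <= u by rewrite v1.
apply: (le_trans (zero_level_bound _ _ _ _ _ G1 M1 vu' uG)).
by rewrite ler_wpM2l ?powR_ge0// ler_peMl.
Qed.

(** * Covering an integral *)

(** The integral of a nonnegative function is a supremum over the simple functions below it, and a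
    larger function has more of them. This allows [alpha] to be compared pointwise with a sum of
    indicators. *)
Lemma ge0_le_integral_nonmeasurable d (T : measurableType d) (R : realType)
    (mu : {measure set T -> \bar R}) (D : set T) (f g : T -> \bar R) :
  (forall x, D x -> (0 <= f x)%E) -> (forall x, D x -> (f x <= g x)%E) ->
  (\int[mu]_(x in D) f x <= \int[mu]_(x in D) g x)%E.
Proof.
move=> f0 fg; have g0 x : D x -> (0 <= g x)%E.
  by move=> Dx; exact: le_trans (f0 _ Dx) (fg _ Dx).
rewrite !ge0_integralE//; apply: ereal_sup_le => _ [h /= hf <-].
by exists h => //= x; apply: (le_trans (hf x)); exact: lee_restrict.
Qed.

(** Pointwise f is at most the sum of the c i times the indicators of F i: one suitable set at each
    point is enough, the other terms being nonnegative. *)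
Lemma integral_le_cover (R : realType) (D : set R) (f : R -> R) (I : finType)
    (P : pred I) (c l : I -> R) (F : I -> set R) :
  measurable D -> (forall i, P i -> measurable (F i)) ->
  (forall i, P i -> (lebesgue_measure (F i) <= (l i)%:E)%E) ->
  (forall i, 0 <= c i) -> (forall x, D x -> 0 <= f x) ->
  (forall x, D x -> exists2 i, P i & F i x /\ f x <= c i) ->
  (\int[lebesgue_measure]_(x in D) (f x)%:E <= (\sum_(i | P i) c i * l i)%:E)%E.
Proof.
move=> mD mF lF c0 f0 cover.
pose F' i : set R := if P i then F i else set0.
have mF' i : measurable (F' i) by rewrite /F'; case: ifPn => // /mF.
pose s := [seq i <- index_enum I | P i].
pose g x : \bar R := (\sum_(i <- s) (c i)%:E * (\1_(F' i) x)%:E)%E.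
have term0 i x : (0 <= (c i)%:E * (\1_(F' i) x)%:E)%E.
  by rewrite mule_ge0// lee_fin.
apply: (@le_trans _ _ (\int[lebesgue_measure]_(x in D) g x)%E).
  apply: ge0_le_integral_nonmeasurable => x Dx; first by rewrite lee_fin f0.
  have [i Pi [Fix fc]] := cover x Dx.
  rewrite /g /s big_filter (bigD1 i)//=.
  rewrite /F' Pi indicE mem_set// mule1; apply: le_trans (leeDl _ _).
    by rewrite lee_fin.
  by apply: sume_ge0 => j _; exact: term0.
rewrite /g ge0_integral_sum//; last first.
  move=> i; apply: measurable_funeM; apply/measurable_realfun.measurable_EFinP.
  by apply: measurable_realfun.measurable_indic; exact: mF'.
rewrite -sumEFin /s big_filter; apply: lee_sum => i Pi.
rewrite ge0_integralZl_EFin//; last first.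
  by apply/measurable_realfun.measurable_EFinP;
    apply: measurable_realfun.measurable_indic; exact: mF'.
rewrite integral_indic ?(EFinM (c i)); [|exact: mD|exact: mF'].
apply: lee_wpmul2l; first by rewrite lee_fin.
apply: le_trans (lF _ Pi); rewrite /F' Pi; apply: le_measure => //.
- by rewrite inE; apply: measurableI => //; exact: mF.
- by rewrite inE; exact: mF.
Qed.

(** Covers the solutions xi of |p x |xi| - q| <= r by two intervals symmetric about 0, so that
    measurability and measure are immediate. *)
Definition rational_band (R : realType) (x r : R) (p q : nat) : set R :=
  `[(q%:R - r) / (p%:R * x), (q%:R + r) / (p%:R * x)]%classic `|`
  `[- ((q%:R + r) / (p%:R * x)), - ((q%:R - r) / (p%:R * x))]%classic.

Lemma measurable_rational_band (R : realType) (x r : R) p q : measurable (rational_band R x r p q).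
Proof. by apply: measurableU; exact: measurable_itv. Qed.

Lemma rational_bandP (R : realType) (x r xi : R) p q : 0 < x -> (0 < p)%N ->
  `|p%:R * x * `|xi| - q%:R| <= r -> rational_band _ x r p q xi.
Proof.
move=> x0 p0; rewrite ler_norml => /andP[h1 h2].
have px0 : 0 < p%:R * x by rewrite mulr_gt0 ?ltr0n.
have [xi0|xi0] := leP 0 xi; [left|right]; rewrite /= in_itv /=.
- rewrite ger0_norm// in h1 h2.
  by rewrite ler_pdivrMr// ler_pdivlMr// ![xi * _]mulrC; apply/andP; split; lra.
- rewrite ltr0_norm// in h1 h2.
  rewrite -[xi]opprK !lerN2 ler_pdivrMr// ler_pdivlMr// ![- xi * _]mulrC.
  by apply/andP; split; lra.
Qed.

Lemma measure_rational_band (R : realType) (x r : R) p q : 0 < x -> 0 <= r -> (0 < p)%N ->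
  (lebesgue_measure (rational_band _ x r p q) <= (4 * r / (p%:R * x))%:E)%E.
Proof.
move=> x0 r0 p0; have px0 : 0 < p%:R * x by rewrite mulr_gt0 ?ltr0n.
have r2 : 0 <= 2 * r / (p%:R * x) by rewrite divr_ge0 ?mulr_ge0// ltW.
have itv_le (a b : R) : b - a = 2 * r / (p%:R * x) ->
    (lebesgue_measure (`[a, b]%classic : set R) <= (2 * r / (p%:R * x))%:E)%E.
  move=> e; rewrite lebesgue_measure_itv/=; case: ifP => _.
    by rewrite -EFinB e.
  by rewrite lee_fin.
apply: (le_trans (measureU2 _ _ _)); try exact: measurable_itv.
rewrite (_ : 4 * r / (p%:R * x) = 2 * r / (p%:R * x) + 2 * r / (p%:R * x)); last by ring.
rewrite EFinD; apply: leeD; apply: itv_le; field; by rewrite (gt_eqF x0) gt_eqF ?ltr0n.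
Qed.

(** * The height function *)

(** The Euclidean norm of (p, q) g_0 n(xi) a(log M) in one coordinate, with x = x_j. *)
Definition row_norm (R : realType) (x M xi : R) (p q : int) : R :=
  Num.sqrt ((p%:~R * x `^ (2^-1) / M) ^+ 2 +
            (M * (p%:~R * x `^ (2^-1) * xi + q%:~R * x `^ (- 2^-1))) ^+ 2).

(** Coprimality in the form given by the determinant: (r, s) is the top row of a matrix in SL(2,Z)
    with bottom row (p, q). *)
Definition primitive_row (p q : int) : Prop := exists r s : int, r * q - s * p = 1.

Lemma powR_half_sqr (R : realType) (x : R) : 0 < x ->
  [/\ 0 < x `^ (2^-1), x `^ (2^-1) ^+ 2 = x & x `^ (- 2^-1) = (x `^ (2^-1))^-1].
Proof.
move=> x0; split; first exact: powR_gt0.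
  by rewrite -powR_mulrn ?powR_ge0// -powRrM mulVf// powRr1// ltW.
exact: powRN.
Qed.

Lemma primitive_row_p0 (q : int) : primitive_row 0 q -> 1 <= `|q|.
Proof.
move=> [r [s]]; rewrite mulr0 subr0 => rq; rewrite -gtz0_ge1 normr_gt0.
by apply: contra_eq_neq rq => ->; rewrite mulr0.
Qed.

Lemma primitive_row_q0 (p : int) : primitive_row p 0 -> `|p|%N = 1%N.
Proof.
move=> [r [s]]; rewrite mulr0 sub0r => /(congr1 absz); rewrite abszN abszM.
by move/eqP; rewrite muln_eq1 => /andP[_ /eqP].
Qed.

Lemma row_norm_ge (R : realType) (x M xi : R) (p q : int) :
  `|p%:~R * x `^ (2^-1) / M| <= row_norm R x M xi p q /\
  `|M * (p%:~R * x `^ (2^-1) * xi + q%:~R * x `^ (- 2^-1))| <= row_norm R x M xi p q.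
Proof.
rewrite /row_norm -!sqrtr_sqr; split; apply: ler_wsqrtr.
  by rewrite lerDl sqr_ge0.
by rewrite lerDr sqr_ge0.
Qed.

(** If p = 0 the second coordinate is at least x^(-1/2) in size, otherwise the first is at least
    x^(1/2)/M. The first bound makes the levels finite, the second excludes p = 0 at high levels. *)
Lemma row_norm_lower (R : realType) (K x M xi : R) (p q : int) :
  0 < x -> 1 <= M -> x `^ (2^-1) <= K -> x `^ (- 2^-1) <= K ->
  primitive_row p q -> (K * M)^-1 <= row_norm R x M xi p q /\
    (p = 0 -> K^-1 <= row_norm R x M xi p q).
Proof.
move=> x0 M1 K1 K2 pq; have [y0 y2 yV] := powR_half_sqr _ _ x0.
have M0 : 0 < M by lra.
have K0 : 0 < K by apply: lt_le_trans K1.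
have [h1 h2] := row_norm_ge R x M xi p q.
rewrite yV in K2 h2.
set y := x `^ _ in y0 y2 K1 K2 h1 h2 *.
have p0case : p = 0 -> K^-1 <= row_norm R x M xi p q.
  move=> p0; apply: le_trans h2; rewrite p0 in pq *.
  have q1 := primitive_row_p0 _ pq.
  rewrite mul0r mul0r add0r !normrM (gtr0_norm M0) normfV (gtr0_norm y0).
  have q1' : 1 <= `|q%:~R : R| by rewrite -intr_norm (ler_int R 1).
  apply: (@le_trans _ _ y^-1); first by rewrite lef_pV2.
  rewrite mulrA ler_peMl ?invr_ge0 ?(ltW y0)//.
  by rewrite mulr_ege1.
split => //; have [p0|pn0] := eqVneq p 0.
  apply: le_trans (p0case p0); rewrite lef_pV2 ?posrE ?mulr_gt0//.
  by rewrite ler_peMr// ltW.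
apply: le_trans h1; rewrite !normrM normfV (gtr0_norm M0) (gtr0_norm y0).
have p1' : 1 <= `|p%:~R : R| by rewrite -intr_norm (ler_int R 1) -gtz0_ge1 normr_gt0.
apply: (@le_trans _ _ (y / M)); last by rewrite ler_pM2r ?invr_gt0// ler_peMl// ltW.
rewrite invfM ler_pM2r ?invr_gt0//.
by rewrite -(invrK y) lef_pV2 ?posrE ?invr_gt0.
Qed.

(** Both coordinates of a row are at most its norm: the first bounds p, and the second, multiplied
    by x^(1/2), is the rational approximation. The margin omega narrows the bands so that resonances
    between two of them have a small constant. *)
Lemma row_norm_large (R : realType) (K omega x M xi u : R) (p q : int) :
  0 < x -> 1 <= M -> x `^ (2^-1) <= K -> x `^ (- 2^-1) <= K -> 1 <= omega -> 1 <= u ->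
  primitive_row p q -> K * omega * u < (row_norm R x M xi p q)^-1 ->
  [/\ (0 < `|p|)%N, `|p|%:R * (omega * u) <= M,
    `| `|p|%:R * x * `|xi| - `|q|%:R| <= (M * omega * u)^-1 &
    `|q|%N = 0%N -> `|p|%N = 1%N].
Proof.
move=> x0 M1 K1 K2 om1 u1 pq h; have [y0 y2 yV] := powR_half_sqr _ _ x0.
have [M0 om0 u0] : [/\ 0 < M, 0 < omega & 0 < u] by split; lra.
have K0 : 0 < K by apply: lt_le_trans K1.
have [l1 l2] := row_norm_lower _ _ _ _ xi _ _ x0 M1 K1 K2 pq.
have [h1 h2] := row_norm_ge R x M xi p q.
set n := row_norm R x M xi p q in h l1 l2 h1 h2.
have n0 : 0 < n by apply: lt_le_trans l1; rewrite invr_gt0 mulr_gt0.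
have T0 : 0 < K * omega * u by rewrite !mulr_gt0.
have nT : n <= (K * omega * u)^-1.
  by rewrite -(invrK n) lef_pV2 ?posrE ?invr_gt0// ltW.
rewrite yV in K2 h2.
set y := x `^ _ in y0 y2 K1 K2 h1 h2 *.
have pn0 : p != 0.
  apply: contraTneq h => p0; rewrite -leNgt.
  apply: (@le_trans _ _ K); last first.
    by rewrite -mulrA ler_peMr ?(ltW K0)// mulr_ege1.
  by rewrite -(invrK K) lef_pV2 ?posrE ?invr_gt0// l2.
have pE : (`|p|%N)%:R = `|p%:~R : R| by rewrite natr_absz intr_norm.
have qE : (`|q|%N)%:R = `|q%:~R : R| by rewrite natr_absz intr_norm.
split.
- by rewrite absz_gt0.
- have := le_trans h1 nT; rewrite !normrM normfV (gtr0_norm M0) (gtr0_norm y0) -pE.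
  rewrite ler_pdivrMr// [_^-1 * M]mulrC ler_pdivlMr// => g.
  apply: le_trans g; set P := (`|p|%N)%:R.
  rewrite (_ : P * y * (K * omega * u) = y * K * (P * (omega * u))); last by ring.
  rewrite ler_peMl ?mulr_ge0 ?(ltW om0) ?(ltW u0)//.
  by rewrite -(divff (lt0r_neq0 y0)) ler_pM2l.
- have := le_trans h2 nT; rewrite normrM (gtr0_norm M0) => g.
  have gx : `|p%:~R * x * xi + q%:~R : R| <= (M * omega * u)^-1.
    rewrite (_ : p%:~R * x * xi + q%:~R = y * (p%:~R * y * xi + q%:~R / y)); last first.
      by rewrite -y2; field; rewrite gt_eqF.
    rewrite normrM (gtr0_norm y0) -(ler_pM2l M0) mulrCA.
    apply: (le_trans (ler_wpM2l (ltW y0) g)).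
    apply: (@le_trans _ _ (K * (K * omega * u)^-1)).
      by rewrite ler_pM2r ?invr_gt0.
    by rewrite le_eqVlt; apply/orP; left; apply/eqP; field; rewrite !gt_eqF.
  (* Signs are removed by the reverse triangle inequality. *)
  apply: le_trans gx; rewrite pE qE.
  have -> : `|p%:~R : R| * x * `|xi| = `|p%:~R * x * xi|.
    by rewrite !normrM (gtr0_norm x0).
  rewrite -[q%:~R in leRHS]opprK -(normrN q%:~R).
  exact: ler_dist_dist.
- move=> /eqP; rewrite absz_eq0 => /eqP q0; apply: primitive_row_q0.
  by rewrite q0 in pq.
Qed.

Lemma rho_row_norm (R : realType) (n : nat) (x : 'I_n -> R) (M xi : R)
    (gam : 'I_n -> 'M[int]_2) : 0 < M ->
  rho (lmulZ gam (fun j => g0 x j *m nmx xi *m amx (ln M))) =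
  \prod_(j < n) row_norm R (x j) M xi (gam j ord_max ord0) (gam j ord_max ord_max).
Proof.
move=> M0; rewrite /rho; apply: eq_bigr => j _.
rewrite /row_norm /lmulZ /g0 /nmx /amx /mx2 expRN lnK//.
rewrite !mxE !big_ord_recl !big_ord0 !mxE !big_ord_recl !big_ord0 !mxE.
rewrite !big_ord_recl !big_ord0 !mxE /=.
have -> : lift ord0 (ord0 : 'I_1) = ord_max :> 'I_2 by apply/val_inj.
congr (Num.sqrt (_ ^+ 2 + _ ^+ 2)); ring.
Qed.

Lemma primitive_row_SL2Z (n : nat) (gam : 'I_n -> 'M[int]_2) (j : 'I_n) :
  SL2Z n gam -> primitive_row (gam j ord_max ord0) (gam j ord_max ord_max).
Proof.
move=> /(_ j); rewrite det_mx2 => d.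
by exists (gam j ord0 ord0), (gam j ord0 ord_max).
Qed.

(** The upper bound holds factor by factor. Once it makes the set bounded, the supremum is at least
    the nonnegative value at the identity. *)
Lemma alpha_le_prod (R : realType) (n : nat) (x : 'I_n -> R) (M xi : R) (A : 'I_n -> R) :
  0 < M -> (forall j p q, primitive_row p q -> (row_norm R (x j) M xi p q)^-1 <= A j) ->
  0 <= alpha (fun j => g0 x j *m nmx xi *m amx (ln M)) <= \prod_(j < n) A j.
Proof.
move=> M0 HA; rewrite /alpha; set S := [set _ | _ in _].
have ubS : ubound S (\prod_(j < n) A j).
  move=> _ [gam Hg <-]; rewrite rho_row_norm// -prodfV; apply: ler_prod => j _.
  by rewrite invr_ge0 sqrtr_ge0 /= HA//; exact: primitive_row_SL2Z.
have S1 : S (rho (lmulZ (fun=> 1%:M) (fun j => g0 x j *m nmx xi *m amx (ln M))))^-1.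
  by exists (fun=> 1%:M) => // j; rewrite det1.
apply/andP; split; last by apply: ge_sup => //; exists (rho (lmulZ (fun=> 1%:M)
  (fun j => g0 x j *m nmx xi *m amx (ln M))))^-1.
have hu : has_ubound S by exists (\prod_(j < n) A j).
have /(_ _ S1) := ub_le_sup hu; apply: le_trans.
by rewrite invr_ge0; apply: prodr_ge0 => j _; rewrite sqrtr_ge0.
Qed.

(** Take for [a j] the least dyadic level bounding all inverse norms in coordinate j. If it is
    positive, minimality yields a row exceeding the preceding level, to which [row_norm_large]
    applies. *)
Lemma alpha_level (R : realType) (n : nat) (x : 'I_n -> R) (K omega M xi : R) :
  (forall j, 0 < x j) -> (forall j, x j `^ (2^-1) <= K) ->
  (forall j, x j `^ (- 2^-1) <= K) -> 1 <= omega -> 1 <= M -> 0 < K ->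
  exists a : 'I_n -> nat,
    0 <= alpha (fun j => g0 x j *m nmx xi *m amx (ln M))
      <= \prod_(j < n) (2 * K * omega * 2 ^+ a j) /\
  forall j, (0 < a j)%N -> exists p q : nat,
   [/\ (0 < p)%N, p%:R * (omega * 2 ^+ a j) <= M,
    `| p%:R * x j * `|xi| - q%:R| <= (M * omega * 2 ^+ a j)^-1 & q = 0%N -> p = 1%N].
Proof.
move=> x0 K1 K2 om1 M1 K0.
have M0 : 0 < M by lra.
pose good j (a : nat) := forall p q : int, primitive_row p q ->
  (row_norm R (x j) M xi p q)^-1 <= 2 * K * omega * 2 ^+ a.
have exgood j : exists a, `[< good j a >].
  pose a := (Num.truncn M).+1.
  have Ma : M <= 2 ^+ a.
    have /andP[_ h] := @truncn_itv R M (ltW M0); apply: (le_trans (ltW h)).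
    by rewrite -/a -natrX ler_nat ltnW// ltn_expl.
  exists a; apply/asboolP => p q pq.
  have [h _] := row_norm_lower _ _ _ _ xi _ _ (x0 j) M1 (K1 j) (K2 j) pq.
  have KM : 0 < K * M by rewrite mulr_gt0.
  apply: (@le_trans _ _ (K * M)).
    rewrite -(invrK (K * M)) lef_pV2 ?posrE ?invr_gt0//.
    by apply: lt_le_trans h; rewrite invr_gt0.
  have : K * M <= K * 2 ^+ a by rewrite ler_pM2l.
  have : K * 2 ^+ a <= K * 2 ^+ a * omega by rewrite ler_peMr// mulr_ge0 ?exprn_ge0// ltW.
  have : 0 <= K * 2 ^+ a * omega by rewrite !mulr_ge0 ?exprn_ge0//; lra.
  lra.
have [a Ha] : exists a : 'I_n -> nat, forall j,
    good j (a j) /\ ((0 < a j)%N -> ~ good j (a j).-1).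
  exists (fun j => ex_minn (exgood j)) => j; case: ex_minnP => m /asboolP gm mmin.
  by split => // m0 /asboolP /mmin; rewrite leqNgt ltn_predL m0.
exists a; split; first by apply: alpha_le_prod => // j p q; exact: (Ha j).1.
move=> j aj0.
have /existsNP[p /existsNP[q /not_implyP[pq /negP]]] := (Ha j).2 aj0.
rewrite -ltNge.
(* The leading 2 in the definition of the levels compensates for the step down. *)
have -> : 2 * K * omega * 2 ^+ (a j).-1 = K * omega * 2 ^+ a j.
  by move: aj0; case: (a j) => // b _; rewrite exprS /=; ring.
move=> h.
have u1 : 1 <= 2 ^+ a j :> R by rewrite exprn_ege1// ler1n.
have [h1 h2 h3 h4] := row_norm_large _ _ _ _ _ _ _ _ _ (x0 j) M1 (K1 j) (K2 j) om1 u1 pq h.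
by exists `|p|%N, `|q|%N.
Qed.

(** The smallest level is replaced by the second largest; for dyadic factors this bounds the product
    by u v^2. *)
Lemma prod3_top_two (a : 'I_3 -> nat) : exists i j : 'I_3,
  [/\ i != j, (a j <= a i)%N & (\sum_k a k <= a i + 2 * a j)%N].
Proof.
rewrite !big_ord_recl big_ord0 addn0.
pose i0 : 'I_3 := ord0; pose i1 : 'I_3 := lift ord0 ord0.
pose i2 : 'I_3 := lift ord0 (lift ord0 ord0).
rewrite -/i0 -/i1 -/i2.
have [ne01 ne02 ne12] : [/\ i0 != i1, i0 != i2 & i1 != i2] by [].
have w (i j k : 'I_3) : i != j -> (a k <= a j)%N -> (a j <= a i)%N ->
    (a i0 + (a i1 + a i2) = a i + a j + a k)%N ->
    exists i j : 'I_3, [/\ i != j, (a j <= a i)%N & (a i0 + (a i1 + a i2) <= a i + 2 * a j)%N].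
  move=> ij kj ji e; exists i, j; split => //; rewrite e; lia.
have [h01|h01] := leqP (a i0) (a i1); have [h12|h12] := leqP (a i1) (a i2);
  have [h02|h02] := leqP (a i0) (a i2).
all: first
 [ by apply: (w i0 i1 i2); rewrite // 1?eq_sym //; lia
 | by apply: (w i0 i2 i1); rewrite // 1?eq_sym //; lia
 | by apply: (w i1 i0 i2); rewrite // 1?eq_sym //; lia
 | by apply: (w i1 i2 i0); rewrite // 1?eq_sym //; lia
 | by apply: (w i2 i0 i1); rewrite // 1?eq_sym //; lia
 | by apply: (w i2 i1 i0); rewrite // 1?eq_sym //; lia].
Qed.

(** * The main estimate *)

Lemma fin_upper_bound (R : realType) (n : nat) (f : 'I_n -> R) :
  exists2 B : R, 1 <= B & forall j, f j <= B.
Proof.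
exists (1 + \sum_j `|f j|); first by rewrite lerDl sumr_ge0.
move=> j; rewrite (bigD1 j)//= addrCA; apply: le_trans (ler_norm _) _.
by rewrite lerDl addr_ge0// sumr_ge0.
Qed.

Lemma numerator_le (R : realType) (x G M L omega u xi : R) (p q : nat) :
  0 < x -> x + 1 <= G -> (0 < p)%N -> 1 <= M -> 1 <= L -> 1 <= omega -> 1 <= u ->
  `|xi| <= L -> `| p%:R * x * `|xi| - q%:R| <= (M * omega * u)^-1 ->
  q%:R <= G * p%:R * L.
Proof.
move=> x0 xG p0 M1 L1 om1 u1 xiL; rewrite ler_norml => /andP[k1 _].
have P1 : (1 : R) <= p%:R by rewrite ler1n.
have : (M * omega * u)^-1 <= 1.
  by rewrite invf_le1 ?mulr_ege1// !mulr_gt0//; lra.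
have : p%:R * x * `|xi| <= p%:R * x * L.
  by rewrite ler_wpM2l// mulr_ge0//; lra.
have : (x + 1) * (p%:R * L) <= G * (p%:R * L).
  by rewrite ler_wpM2r// mulr_ge0//; lra.
have : 1 <= p%:R * L by rewrite mulr_ege1.
rewrite mulrDl mul1r; lra.
Qed.

(** Eliminating |xi| between the two approximations leaves p2 q1 x2 - p1 q2 x1 as a combination of
    their errors with coefficients p1 x1 and p2 x2. *)
Lemma resonant_pairP (R : realType) (x1 x2 tau G M L u v omega eta xi : R)
    (p1 p2 q1 q2 : nat) :
  0 < x1 -> 0 < x2 -> 0 < tau -> tau < x1 -> tau < x2 ->
  x1 + 1 <= G -> x2 + 1 <= G -> x1^-1 <= G ->
  1 <= omega -> x1 + x2 <= omega * tau ->
  1 <= L -> 1 <= M -> 1 <= u -> 1 <= v -> eta <= 3^-1 ->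
  M `^ (- 1 - eta) < `|xi| <= L ->
  [/\ (0 < p1)%N, p1%:R * (omega * u) <= M,
    `| p1%:R * x1 * `|xi| - q1%:R| <= (M * omega * u)^-1 & q1 = 0%N -> p1 = 1%N] ->
  [/\ (0 < p2)%N, p2%:R * (omega * v) <= M,
    `| p2%:R * x2 * `|xi| - q2%:R| <= (M * omega * v)^-1 & q2 = 0%N -> p2 = 1%N] ->
  resonant_pair _ x1 x2 tau G M L u v p1 p2 q1 q2.
Proof.
move=> x10 x20 tau0 tx1 tx2 G1 G2 G1' om1 omt L1 M1 u1 v1 eta3 /andP[xiM xiL].
move=> [p10 h1 h2 h3] [p20 g1 g2 g3].
have [u0 v0 L0 M0 om0] : [/\ 0 < u, 0 < v, 0 < L, 0 < M & 0 < omega] by split; lra.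
have [P1 P2] : (1 : R) <= p1%:R /\ (1 : R) <= p2%:R by rewrite !ler1n; split.
have [P10 P20] : (0 : R) < p1%:R /\ (0 : R) < p2%:R by split; lra.
have hu : p1%:R * u <= M.
  by apply: le_trans h1; rewrite ler_pM2l// ler_peMl// ltW.
have gv : p2%:R * v <= M.
  by apply: le_trans g1; rewrite ler_pM2l// ler_peMl// ltW.
have q1L := numerator_le _ _ _ _ _ _ _ _ _ _ x10 G1 p10 M1 L1 om1 u1 xiL h2.
have q2L := numerator_le _ _ _ _ _ _ _ _ _ _ x20 G2 p20 M1 L1 om1 v1 xiL g2.
have val : `|(p2 * q1)%:R * x2 - (p1 * q2)%:R * x1| <= tau / (u * v).
  rewrite (_ : _ - _ = p1%:R * x1 * (p2%:R * x2 * `|xi| - q2%:R) -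
      p2%:R * x2 * (p1%:R * x1 * `|xi| - q1%:R)); last by rewrite !natrM; ring.
  apply: (le_trans (ler_normB _ _)); rewrite !normrM !normr_nat (gtr0_norm x10) (gtr0_norm x20).
  apply: (@le_trans _ _ (p1%:R * x1 * (M * omega * v)^-1 + p2%:R * x2 * (M * omega * u)^-1)).
    by apply: lerD; apply: ler_wpM2l => //; rewrite mulr_ge0// ltW.
  rewrite (_ : _ + _ = (p1%:R * (omega * u) * x1 + p2%:R * (omega * v) * x2) /
     (M * omega ^+ 2 * (u * v))); last by field; rewrite !gt_eqF.
  rewrite ler_pdivrMr ?mulr_gt0 ?exprn_gt0//.
  rewrite (_ : tau / (u * v) * (M * omega ^+ 2 * (u * v)) = M * omega * (omega * tau)); last first.
    by field; rewrite !gt_eqF.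
  apply: (@le_trans _ _ (M * (x1 + x2))).
    by rewrite mulrDr; apply: lerD; rewrite ler_pM2r.
  rewrite -mulrA ler_pM2l//; apply: (le_trans omt).
  by rewrite ler_peMl// mulr_ge0// ltW.
have tuv : tau / (u * v) <= tau.
  by rewrite ler_pdivrMr ?mulr_gt0// ler_peMr ?(ltW tau0)// mulr_ege1.
rewrite /resonant_pair /resonant p10 p20 hu gv val q1L q2L /=.
(* If q1 = 0 then tau < x1 forces q2 = 0, and p1 = p2 = 1. Now x1 |xi| <= 1/(M u), while |xi| >
   M^(-4/3), so u is O(M^(1/3)). *)
have [q10|//] := posnP q1.
move: (val); rewrite q10 muln0 mul0r sub0r normrN ger0_norm ?mulr_ge0 ?(ltW x10)// => val'.
have q20 : q2 = 0%N.
  apply/eqP; rewrite -leqn0 leqNgt; apply/negP => q2pos.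
  have : 1 <= (p1 * q2)%:R :> R by rewrite ler1n muln_gt0 p10.
  move=> z1; have : x1 <= (p1 * q2)%:R * x1 by rewrite ler_peMl// ltW.
  lra.
rewrite (h3 q10) (g3 q20) q20 !eqxx /=.
move: h2; rewrite q10 (h3 q10) mul1r subr0 normrM (gtr0_norm x10) normr_id => h2.
have e1 : M `^ (- 1 - 3^-1) <= `|xi|.
  by apply: le_trans (ltW xiM); apply: ler_powR => //; lra.
have e2 : x1 * M `^ (- 1 - 3^-1) <= (M * u)^-1.
  apply: (le_trans (ler_wpM2l (ltW x10) e1)); apply: (le_trans h2).
  by rewrite lef_pV2 ?posrE ?mulr_gt0// ler_pM2r// ler_peMr ?(ltW M0).
rewrite powRDp// powR_inv1 ?(ltW M0)// powRN in e2.
set m := M `^ (3^-1) in e2 *.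
have m0 : 0 < m by exact: powR_gt0.
have : u <= x1^-1 * m.
  move: e2; rewrite -[(M * u)^-1]mul1r ler_pdivlMr ?mulr_gt0//.
  rewrite (_ : x1 * (M^-1 / m) * (M * u) = u / (x1^-1 * m)); last by field; rewrite !gt_eqF.
  by rewrite ler_pdivrMr ?mulr_gt0 ?invr_gt0// mul1r.
by move=> /le_trans; apply; rewrite ler_pM2r.
Qed.

Lemma geometric_double_sum (R : realType) (r : R) (N : nat) : 0 <= r < 1 ->
  \sum_(ab : 'I_N * 'I_N) r ^+ ab.1 * r ^+ ab.2 <= ((1 - r)^-1) ^+ 2.
Proof.
move=> hr; rewrite -(pair_bigA _ (fun a b : 'I_N => r ^+ a * r ^+ b)) /=.
rewrite -big_distrlr /= expr2; have [r0 _] := andP hr.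
by apply: ler_pM; rewrite ?sum_geometric_le// sumr_ge0// => i _; rewrite exprn_ge0.
Qed.

Lemma powR_exp2 (R : realType) (a : nat) (s : R) : (2 ^+ a) `^ s = (2 `^ s) ^+ a.
Proof.
rewrite -(powR_mulrn a (ler0n R 2)) -(powR_mulrn a (powR_ge0 2 s)) -!powRrM.
by rewrite mulrC.
Qed.

Theorem theorem1p3 (R : realType) :
  let d := 3%N in
  exists2 kappa0 : R, 1 < kappa0 &
  forall kappa : R, 1 <= kappa < kappa0 ->
  forall x : 'I_d -> R,
    (forall j, 0 < x j) ->
    (forall i j, i != j -> diophantine kappa (x i / x j)) ->
  forall delta : R, 0 < delta < (kappa + 1)^-1 ->
  exists2 eta0 : R, 0 < eta0 &
  forall eta : R, 0 < eta < eta0 ->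
  exists2 beta : R, 1 < beta &
  exists2 C : R, 0 < C &
  forall M L : R, 1 <= M -> 1 <= L <= M ^+ (d - 2) ->
    ((L^-1)%:E *
      \int[lebesgue_measure]_(xi in [set xi : R | (M `^ (- 1 - eta) < `|xi| <= L)%R])
        (alpha (fun j => g0 x j *m nmx xi *m amx (ln M)) `^ beta)%:E
     <= (C * (1 + L^-1 * M `^ ((d - 2)%:R - delta)))%:E)%E.
Proof.
(* For kappa < 8/7 one has 1/kappa > 7/8, the saving built into the exponents of [level_bound]. *)
move=> d; exists (8 / 7); first by lra.
move=> kap hk x x0 dio delta /andP[_ del1].
have [kap1 _] := andP hk.
have del2 : delta < 2^-1.
  by apply: (lt_le_trans del1); rewrite lef_pV2 ?posrE//; lra.
(* For eta <= 1/3 the cutoff is at least M^(-4/3), which confines the row (1, 0) to levels u =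
   O(M^(1/3)). *)
exists 3^-1; first by rewrite invr_gt0.
move=> eta /andP[_ /ltW eta3]; exists (13 / 12); first by lra.
have [K K1 KP] := fin_upper_bound R d (fun j => x j `^ (2^-1) + x j `^ (- 2^-1)).
have KP1 j : x j `^ (2^-1) <= K.
  by apply: le_trans (KP j); rewrite lerDl powR_ge0.
have KP2 j : x j `^ (- 2^-1) <= K.
  by apply: le_trans (KP j); rewrite lerDr powR_ge0.
have [G G1 GP] := fin_upper_bound R d (fun j => x j + 1 + (x j)^-1).
have GP1 j : x j + 1 <= G.
  by apply: le_trans (GP j); rewrite lerDl invr_ge0 ltW.
have GP2 j : (x j)^-1 <= G.
  by apply: le_trans (GP j); have := x0 j; lra.
have [K0 G0] : 0 < K /\ 0 < G by split; lra.
(* Then 4 tau = 1/G <= x_j for every j, so all smallness conditions on tau hold at once. *)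
pose tau := (4 * G)^-1.
have tau0 : 0 < tau by rewrite invr_gt0 mulr_gt0.
have taux j : 4 * tau <= x j.
  rewrite (_ : 4 * tau = G^-1); last by rewrite /tau; field; rewrite gt_eqF.
  by rewrite -(invrK (x j)) lef_pV2 ?posrE ?invr_gt0.
(* Chosen so that omega tau >= x_i + x_j, as [resonant_pairP] demands. *)
pose omega := 1 + 2 * G / tau.
have om1 : 1 <= omega by rewrite lerDl divr_ge0 ?mulr_ge0// ltW.
have om0 : 0 < omega by lra.
have omt i j : x i + x j <= omega * tau.
  have -> : omega * tau = tau + 2 * G by rewrite /omega; field; rewrite gt_eqF.
  by have := GP1 i; have := GP1 j; lra.
(* One constant for each ordered pair of indices, with a dummy value on the diagonal; their sum [Cs]
   serves for all pairs. *)
have /choice [Cp HCp] : forall ij : 'I_d * 'I_d, exists C : R, 0 < C /\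
    (ij.1 != ij.2 -> forall (M L u v : R) (N : nat),
    1 <= L <= M -> 1 <= v <= u ->
    u `^ (13 / 12) * v `^ (13 / 6) *
    \sum_(t : ('I_N * 'I_N) * ('I_N * 'I_N) |
      resonant_pair _ (x ij.1) (x ij.2) tau G M L u v t.1.1 t.1.2 t.2.1 t.2.2)
      Num.min (M * u * t.1.1%:R)^-1 (M * v * t.1.2%:R)^-1
    <= C * ((L + M `^ (1 - delta)) * (u * v) `^ (- 8%:R^-1))).
  move=> [i j] /=; have [_|ij] := eqVneq i j; first by exists 1.
  have ji : j != i by rewrite eq_sym.
  have [c c0 Hc] := diophantine_nat _ _ _ _ (x0 i) (dio j i ji).
  have ti : 2 * tau < x i by have := taux i; lra.
  have tj : tau < x j by have := taux j; lra.
  have [C C0 HC] := pair_level_sum _ _ _ _ _ _ _ (x0 i) (x0 j) c0 hk Hc tau0 ti tj G1.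
  by exists C; split => // _ M L u v N LM uv; exact: HC.
pose Cs := \sum_ij Cp ij.
have Cp0 ij : 0 < Cp ij by have [] := HCp ij.
have Cs0 : 0 <= Cs by apply: sumr_ge0 => ij _; exact: ltW.
have CpCs ij : Cp ij <= Cs.
  by rewrite /Cs (bigD1 ij)//= lerDl sumr_ge0// => k _; exact: ltW.
pose beta : R := 13 / 12.
pose c0 := ((2 * K * omega) ^+ 3) `^ beta.
have c00 : 0 < c0 by rewrite powR_gt0 ?exprn_gt0 ?mulr_gt0.
(* Over dyadic u and v the factor (u v)^(-1/8) sums to two geometric series of ratio r. *)
pose r : R := 2 `^ (- 8%:R^-1).
have r0 : 0 < r by exact: powR_gt0.
have r1 : r < 1.
  by rewrite /r powRN invf_lt1 ?powR_gt0// /powR pnatr_eq0/= expR_gt1 mulr_gt0// ln_gt0// ltr1n.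
have hr : 0 <= r < 1 by rewrite (ltW r0).
pose g := (1 - r)^-1.
have gg0 : 0 <= g by rewrite invr_ge0; lra.
(* The three terms belong to points with no, one, or at least two positive levels; 24 counts 3
   indices times 8, and 36 counts 9 pairs times 4. *)
pose C := c0 * (2 + 24 * G ^+ 2 * g + 36 * G * Cs * g ^+ 2).
have C0 : 0 < C.
  rewrite mulr_gt0//.
  have : 0 <= 24 * G ^+ 2 * g by rewrite !mulr_ge0 ?exprn_ge0// ltW.
  have : 0 <= 36 * G * Cs * g ^+ 2 by rewrite !mulr_ge0 ?exprn_ge0// ltW.
  lra.
exists C => // M L M1; rewrite -[(d - 2)%N]/1%N expr1 => LM.
have /andP[L1 LM'] := LM.
have [L0 M0] : 0 < L /\ 0 < M by split; lra.
set D := [set xi : R | _].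
set f := fun xi : R => alpha (fun j => g0 x j *m nmx xi *m amx (ln M)).
suff main : (\int[lebesgue_measure]_(xi in D) (f xi `^ beta)%:E
    <= (C * (L + M `^ (1 - delta)))%:E)%E.
  have -> : (C * (1 + L^-1 * M `^ (1%:R - delta))) = L^-1 * (C * (L + M `^ (1 - delta))).
    by field; rewrite gt_eqF.
  by rewrite EFinM; apply: lee_wpmul2l => //; rewrite lee_fin invr_ge0 ltW.
have fmin_ge0 (a b : R) : 0 <= a -> 0 <= b -> 0 <= Num.min a b by rewrite le_min => -> ->.
(* Every p, q and level a that occurs is below N: p <= M, q <= G p L <= G M M, and a < 2^a <= M. *)
pose N := (Num.truncn (G * M * M)).+1.
have ltN (n : nat) : n%:R <= G * M * M -> (n < N)%N.
  by move=> h; rewrite ltnS truncn_ge_nat// !mulr_ge0// ltW.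
pose T := (('I_N * 'I_N) * ('I_N * 'I_N))%type.
pose u (a : nat) : R := 2 ^+ a.
have u1 a : 1 <= u a by rewrite exprn_ege1// ler1n.
have u0 a : 0 < u a by have := u1 a; lra.
pose rad (a : nat) := (M * omega * u a)^-1.
have rad0 a : 0 <= rad a by rewrite invr_ge0 !mulr_ge0// ltW.
pose wt (t : T) (a b : nat) := Num.min (M * u a * t.1.1%:R)^-1 (M * u b * t.1.2%:R)^-1.
(* Index of the cover: the whole interval, a band for one coordinate at one level, or the
   intersection of two bands for two coordinates and their levels. *)
pose I : finType := ((unit + ('I_d * 'I_N) * ('I_N * 'I_N)) +
   (('I_d * 'I_d) * ('I_N * 'I_N)) * T)%type.
pose P (s : I) : bool := match s with
  | inl (inl _) => true
  | inl (inr t) => [&& (0 < t.2.1)%N, t.2.1%:R * u t.1.2 <= M & t.2.2%:R <= G * t.2.1%:R * L]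
  | inr t => ((t.1.1.1 != t.1.1.2) && (t.1.2.2 <= t.1.2.1)%N) &&
     resonant_pair _ (x t.1.1.1) (x t.1.1.2) tau G M L (u t.1.2.1) (u t.1.2.2)
       t.2.1.1 t.2.1.2 t.2.2.1 t.2.2.2
  end.
pose c (s : I) : R := match s with
  | inl (inl _) => c0
  | inl (inr t) => c0 * u t.1.2 `^ beta
  | inr t => c0 * (u t.1.2.1 `^ beta * u t.1.2.2 `^ (13 / 6))
  end.
pose l (s : I) : R := match s with
  | inl (inl _) => 2 * L
  | inl (inr t) => 4 * G * (M * u t.1.2 * t.2.1%:R)^-1
  | inr t => 4 * G * wt t.2 t.1.2.1 t.1.2.2
  end.
pose F (s : I) : set R := match s with
  | inl (inl _) => `[- L, L]%classic
  | inl (inr t) => rational_band _ (x t.1.1) (rad t.1.2) t.2.1 t.2.2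
  | inr t => rational_band _ (x t.1.1.1) (rad t.1.2.1) t.2.1.1 t.2.2.1 `&`
             rational_band _ (x t.1.1.2) (rad t.1.2.2) t.2.1.2 t.2.2.2
  end.
have bump_le j a (p q : nat) : (0 < p)%N ->
    (lebesgue_measure (rational_band R (x j) (rad a) p q) <= (4 * G * (M * u a * p%:R)^-1)%:E)%E.
  move=> p0; apply: (le_trans (measure_rational_band _ _ _ _ _ (x0 j) (rad0 a) p0)).
  have P0 : (0 : R) < p%:R by rewrite ltr0n.
  rewrite lee_fin /rad (_ : 4 * (M * omega * u a)^-1 / (p%:R * x j) =
     4 * (x j)^-1 * (omega^-1 * (M * u a * p%:R)^-1)); last first.
    by field; rewrite !gt_eqF.
  apply: ler_pM; rewrite ?mulr_ge0 ?invr_ge0 ?mulr_ge0 ?(ltW (x0 j)) ?(ltW om0)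
    ?(ltW M0) ?(ltW (u0 a))//.
    by rewrite ler_pM2l.
  rewrite ler_piMl ?invr_ge0 ?mulr_ge0 ?(ltW M0) ?(ltW (u0 a))//.
  by rewrite invf_le1.
have S1 : \sum_(i : unit) c (inl (inl i)) * l (inl (inl i)) = c0 * (2 * L).
  by rewrite (eq_bigr (fun=> c0 * (2 * L)))// sumr_const card_unit mulr1n.
have S2 : \sum_(t | P (inl (inr t))) c (inl (inr t)) * l (inl (inr t)) <=
   c0 * (24 * G ^+ 2 * g * L).
  rewrite /=.
  rewrite -(pair_big_dep xpredT (fun (ja : 'I_d * 'I_N) (t : 'I_N * 'I_N) =>
     [&& (0 < t.1)%N, t.1%:R * u ja.2 <= M & t.2%:R <= G * t.1%:R * L])
     (fun ja t => c0 * u ja.2 `^ beta * (4 * G * (M * u ja.2 * t.1%:R)^-1))) /=.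
  apply: (@le_trans _ _ (\sum_(ja : 'I_d * 'I_N) c0 * (8 * G ^+ 2 * L) * r ^+ ja.2)).
    apply: ler_sum => -[j a] _ /=; rewrite -!mulr_sumr.
    have E0 : 0 <= c0 * u a `^ beta by rewrite mulr_ge0 ?powR_ge0// ltW.
    have h := single_level_sum _ _ _ _ _ N G1 L1 M1 (u1 a).
    have h4 := ler_wpM2l (mulr_ge0 (ler0n _ 4) (ltW G0)) h.
    apply: (le_trans (ler_wpM2l E0 h4)).
    rewrite (_ : c0 * u a `^ beta * _ =
      c0 * (8 * G ^+ 2 * L) * (u a `^ beta * (u a ^+ 2)^-1)); last first.
      by field; rewrite gt_eqF.
    rewrite ler_wpM2l ?mulr_ge0 ?exprn_ge0 ?(ltW c00) ?(ltW G0) ?(ltW L0)//.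
    (* Here beta - 2 = -11/12 is below -1/8, so the same ratio r can be used. *)
    rewrite /r -powR_exp2 -/(u a) -[u a ^+ 2]powR_mulrn ?(ltW (u0 a))// -powRN -powRDp//.
    by apply: ler_powR => //; rewrite /beta; lra.
  rewrite -mulr_sumr -(pair_bigA _ (fun (j : 'I_d) (a : 'I_N) => r ^+ a)) /=.
  rewrite sumr_const card_ord -[X in _ * X]mulr_natl.
  rewrite (_ : c0 * (24 * G ^+ 2 * g * L) = c0 * (8 * G ^+ 2 * L) * (3%:R * g)); last by ring.
  rewrite ler_wpM2l ?mulr_ge0 ?exprn_ge0 ?(ltW c00) ?(ltW G0) ?(ltW L0)//.
  by rewrite ler_wpM2l// sum_geometric_le.
have LMd : 0 <= L + M `^ (1 - delta) by have := powR_ge0 M (1 - delta); lra.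
have S3 : \sum_(t | P (inr t)) c (inr t) * l (inr t) <=
   c0 * (36 * G * Cs * g ^+ 2) * (L + M `^ (1 - delta)).
  rewrite /=.
  rewrite -(pair_big_dep (fun s : ('I_d * 'I_d) * ('I_N * 'I_N) =>
       (s.1.1 != s.1.2) && (s.2.2 <= s.2.1)%N)
     (fun s (t : T) => resonant_pair _ (x s.1.1) (x s.1.2) tau G M L (u s.2.1) (u s.2.2)
       t.1.1 t.1.2 t.2.1 t.2.2)
     (fun s t => c0 * (u s.2.1 `^ beta * u s.2.2 `^ (13 / 6)) * (4 * G * wt t s.2.1 s.2.2))) /=.
  (* The majorant is summed over all i, j and all levels; the added terms are nonnegative. *)
  apply: (@le_trans _ _ (\sum_(s : ('I_d * 'I_d) * ('I_N * 'I_N))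
      c0 * 4 * G * Cs * (L + M `^ (1 - delta)) * (r ^+ s.2.1 * r ^+ s.2.2))).
    rewrite big_mkcond; apply: ler_sum => -[[i j] [a b]] _ /=.
    have rr0 : 0 <= r ^+ a * r ^+ b by rewrite mulr_ge0 ?exprn_ge0 ?(ltW r0).
    have [/andP[ij ba]|_] := ifPn; last first.
      by rewrite mulr_ge0// mulr_ge0// mulr_ge0// mulr_ge0 ?(ltW G0)// mulr_ge0// ltW.
    rewrite -!mulr_sumr.
    have uv : 1 <= u b <= u a by rewrite u1 ler_weXn2l// ler1n.
    have [_ /(_ ij M L (u a) (u b) N LM uv)] := HCp (i, j).
    set S := \sum_(_ | _) _; rewrite -/beta => h.
    rewrite (_ : c0 * _ * _ = c0 * 4 * G * (u a `^ beta * u b `^ (13 / 6) * S)); last by ring.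
    have e0 : 0 <= c0 * 4 * G by rewrite !mulr_ge0// ltW.
    rewrite [leRHS](_ : _ = c0 * 4 * G *
      (Cs * ((L + M `^ (1 - delta)) * (r ^+ a * r ^+ b)))); last by ring.
    rewrite ler_wpM2l//; apply: (le_trans h).
    rewrite powRM ?(ltW (u0 _))// !powR_exp2 -/r.
    by rewrite ler_wpM2r ?CpCs// mulr_ge0.
  rewrite -mulr_sumr.
  rewrite -(pair_bigA _ (fun (ij : 'I_d * 'I_d) (ab : 'I_N * 'I_N) => r ^+ ab.1 * r ^+ ab.2)) /=.
  rewrite sumr_const card_prod card_ord -[X in _ * X]mulr_natl.
  rewrite [leRHS](_ : _ =
    c0 * 4 * G * Cs * (L + M `^ (1 - delta)) * ((3 * 3)%:R * g ^+ 2)); last first.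
    by rewrite natrM; ring.
  rewrite ler_wpM2l//.
    by rewrite mulr_ge0// mulr_ge0// mulr_ge0 ?(ltW G0)// mulr_ge0// ltW.
  by rewrite ler_wpM2l// geometric_double_sum.
apply: (@le_trans _ _ (\sum_(s | P s) c s * l s)%:E); last first.
  rewrite lee_fin big_sumType /= big_sumType /= S1.
  apply: (le_trans (lerD (lerD (lexx _) S2) S3)).
  have m0 : 0 <= M `^ (1 - delta) by exact: powR_ge0.
  have a0 : 0 <= 24 * G ^+ 2 * g by rewrite !mulr_ge0 ?exprn_ge0// ltW.
  rewrite (_ : C * (L + M `^ (1 - delta)) = c0 * (2 * L) + c0 * (24 * G ^+ 2 * g * L) +
     c0 * (36 * G * Cs * g ^+ 2) * (L + M `^ (1 - delta)) +
     c0 * (2 + 24 * G ^+ 2 * g) * M `^ (1 - delta)); last by rewrite /C; ring.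
  by rewrite lerDl mulr_ge0// mulr_ge0 ?addr_ge0// ltW.
have alphaP xi := alpha_level _ _ x _ _ _ xi x0 KP1 KP2 om1 M1 K0.
apply: (integral_le_cover _ D (fun xi => f xi `^ beta) I P c l F).
- rewrite (_ : D = `]M `^ (- 1 - eta), L]%classic `|` `[- L, - M `^ (- 1 - eta)[%classic).
    by apply: measurableU; exact: measurable_itv.
  apply/seteqP; split=> xi; rewrite /D /= !in_itv /=.
    have [xi0|xi0] := leP 0 xi; first by rewrite ger0_norm//; left.
    by rewrite ltr0_norm// => /andP[h1 h2]; right; rewrite lerNl h2 ltrNr h1.
  have m0 : 0 < M `^ (- 1 - eta) by exact: powR_gt0.
  move=> [|] /andP[h1 h2].
    by rewrite gtr0_norm ?h1 ?h2// (lt_trans m0).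
  rewrite ltr0_norm ?(lt_trans h2) ?oppr_lt0//.
  by rewrite ltrNr h2 lerNl h1.
- move=> [[[]|t]|t] _ /=; first exact: measurable_itv.
    exact: measurable_rational_band.
  by apply: measurableI; exact: measurable_rational_band.
- move=> [[[]|t]|t] /=.
  + move=> _; rewrite lebesgue_measure_itv/=; case: ifP => _.
      by rewrite -EFinB lee_fin; lra.
    by rewrite lee_fin mulr_ge0// ltW.
  + by move=> /and3P[p0 _ _]; exact: bump_le.
  + move=> /andP[_ /andP[/and3P[p10 p20 _] _]].
    (* The intersection is measured by whichever band has the smaller bound, hence the minimum in
       [wt]. *)
    rewrite /wt /Num.min; case: ifP => _.
      apply: le_trans (bump_le _ _ _ _ p10); apply: le_measure; rewrite ?inE.
      * by apply: measurableI; exact: measurable_rational_band.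
      * exact: measurable_rational_band.
      * exact: subIsetl.
    apply: le_trans (bump_le _ _ _ _ p20); apply: le_measure; rewrite ?inE.
    * by apply: measurableI; exact: measurable_rational_band.
    * exact: measurable_rational_band.
    * exact: subIsetr.
- by move=> [[[]|t]|t] /=; rewrite ?mulr_ge0 ?powR_ge0// ltW.
- by move=> xi _; exact: powR_ge0.
move=> xi Dxi; have [a [/andP[f0 fle] aP]] := alphaP xi.
have [xiM xiL] := andP Dxi.
have [i [j [ij aji sum_le]]] := prod3_top_two a.
(* The product is at most a constant times u v^2, and 2 beta = 13/6. *)
have fb : f xi `^ beta <= c0 * (u (a i) `^ beta * u (a j) `^ (13 / 6)).
  have e : f xi <= (2 * K * omega) ^+ 3 * (u (a i) * u (a j) ^+ 2).
    apply: (le_trans fle); rewrite big_split /= prodr_const card_ord.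
    rewrite ler_pM2l ?exprn_gt0 ?mulr_gt0// prodrXr /u -exprM -exprD.
    by rewrite ler_weXn2l ?ler1n// [(a j * 2)%N]mulnC.
  apply: (@le_trans _ _ (((2 * K * omega) ^+ 3 * (u (a i) * u (a j) ^+ 2)) `^ beta)).
    by apply: ler_powRl => //; rewrite /beta; lra.
  have uu0 k : 0 <= u k by exact: ltW.
  rewrite powRM ?exprn_ge0 ?mulr_ge0 ?exprn_ge0 ?(ltW K0) ?(ltW om0)//.
  rewrite powRM ?exprn_ge0// -(powR_mulrn _ (uu0 (a j))) -powRrM.
  by rewrite (_ : 2%:R * beta = 13 / 6)// /beta; field.
have lvl k : (0 < a k)%N -> exists p q : nat, [/\ (p < N)%N, (q < N)%N, (a k < N)%N,
    q%:R <= G * p%:R * L &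
    [/\ (0 < p)%N, p%:R * (omega * u (a k)) <= M,
    `| p%:R * x k * `|xi| - q%:R| <= rad (a k) & q = 0%N -> p = 1%N]].
  move=> ak0; have [p [q [h1 h2 h3 h4]]] := aP k ak0.
  have P1 : (1 : R) <= p%:R by rewrite ler1n.
  have uk := u1 (a k).
  have ou : 1 <= omega * u (a k) by rewrite mulr_ege1.
  have pM : p%:R <= M by apply: le_trans h2; rewrite ler_peMr.
  have uM : u (a k) <= M.
    apply: le_trans h2; rewrite mulrA ler_peMl ?(ltW (u0 _))//.
    by rewrite mulr_ege1.
  have qL := numerator_le _ _ _ _ _ _ _ _ _ _ (x0 k) (GP1 k) h1 M1 L1 om1 uk xiL h3.
  have MG : M <= G * M * M.
    by rewrite ler_peMl ?(ltW M0)// mulr_ege1.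
  exists p, q; split => //; apply: ltN.
  - exact: le_trans MG.
  - apply: (le_trans qL); rewrite -!mulrA ler_pM2l//.
    by apply: ler_pM => //; exact: ltW.
  - apply: le_trans MG; apply: le_trans uM.
    by rewrite /u -natrX ler_nat ltnW// ltn_expl.
(* The piece containing xi is chosen by which of the two largest levels are positive. *)
have [ai0|ai0] := posnP (a i).
  exists (inl (inl tt)) => //=; split.
    by rewrite in_itv /= -ler_norml.
  apply: (le_trans fb); have -> : a j = 0%N by move: aji; rewrite ai0 leqn0 => /eqP.
  by rewrite ai0 /u expr0 !powR1 !mulr1.
have [p [q [pN qN aN qG [h1 h2 h3 h4]]]] := lvl i ai0.
have [aj0|aj0] := posnP (a j).
  exists (inl (inr ((i, Ordinal aN), (Ordinal pN, Ordinal qN)))) => /=.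
    rewrite h1 qG andbT /=; apply: le_trans h2.
    by rewrite ler_wpM2l// ler_peMl// ltW.
  split; first by apply: rational_bandP.
  by apply: (le_trans fb); rewrite aj0 /u expr0 powR1 mulr1.
have [p' [q' [pN' qN' aN' qG' [h1' h2' h3' h4']]]] := lvl j aj0.
exists (inr (((i, j), (Ordinal aN, Ordinal aN')),
  ((Ordinal pN, Ordinal pN'), (Ordinal qN, Ordinal qN')))) => /=.
  rewrite ij aji /=.
  apply: (resonant_pairP _ _ _ _ _ _ _ _ _ omega eta xi) => //.
  - by have := taux i; lra.
  - by have := taux j; lra.
split => //; split; exact: rational_bandP.
Qed.
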